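(* Let $D$ be an integral domain. The following are equivalent: (1) $D$ is a Jaffard domain; (2) $D[X]$ is a Jaffard domain and $\dim(D[X])=1+\dim(D)$; (3) $D[X]_A$ is a Jaffard domain and $\dim(D[X])=1+\dim(D)$; (4) $D[X]_U$ is a Jaffard domain and $\dim(D[X])=1+\dim(D)$; (5) $D[X]_N$ is a Jaffard domain and $\dim(D[X])=1+\dim(D)$.
   Context: $X$ is an indeterminate over $D$; $A=\{f\in D[X]\mid f(0)=1\}$, $U=\{f\in D[X]\mid f\text{ monic}\}$, $N=\{f\in D[X]\mid c(f)=D\}$ with $c(f)$ the ideal generated by the coefficients of $f$; $D[X]_A$, $D[X]_U$, $D[X]_N$ are the corresponding localizations. $\dim$ denotes Krull dimension. The valuative dimension $\dim_v(D)$ is the supremum of the Krull dimensions of the valuation overrings of $D$; $D$ is a Jaffard domain if $\dim_v(D)<\infty$ and $\dim_v(D)=\dim(D)$. *)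

(* Defs.v *)
From HB Require Import structures.
From mathcomp Require Import all_boot all_order all_algebra.
From mathcomp Require Import fraction.
Set Implicit Arguments. Unset Strict Implicit. Unset Printing Implicit Defensive.
Import Order.TTheory GRing.Theory Num.Theory.
Local Open Scope ring_scope.

(* A domain is represented as a subring R (a predicate) of a field K which is
   its field of fractions.  All ring-theoretic notions below are relative to R. *)

Section SubringsOfField.
Variable K : fieldType.

Definition is_subring (R : K -> Prop) : Prop :=
  [/\ R 1, (forall x y, R x -> R y -> R (x - y)) & (forall x y, R x -> R y -> R (x * y))].

Definition is_ideal (R I : K -> Prop) : Prop :=
  [/\ (forall x, I x -> R x), I 0, (forall x y, I x -> I y -> I (x + y))
    & (forall r x, R r -> I x -> I (r * x))].

Definition is_prime_ideal (R P : K -> Prop) : Prop :=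
  [/\ is_ideal R P, ~ P 1
    & (forall a b, R a -> R b -> P (a * b) -> P a \/ P b)].

Definition has_prime_chain (R : K -> Prop) (n : nat) : Prop :=
  exists P : nat -> K -> Prop,
    (forall i, (i <= n)%N -> is_prime_ideal R (P i)) /\
    (forall i, (i < n)%N ->
       (forall x, P i x -> P i.+1 x) /\ (exists x, P i.+1 x /\ ~ P i x)).

Definition krull_dim_eq (R : K -> Prop) (n : nat) : Prop :=
  has_prime_chain R n /\ ~ has_prime_chain R n.+1.


Definition is_overring (R V : K -> Prop) : Prop :=
  is_subring V /\ (forall x, R x -> V x).

Definition is_valuation_ring (V : K -> Prop) : Prop :=
  forall x, x != 0 -> V x \/ V x^-1.

Definition is_valuation_overring (R V : K -> Prop) : Prop :=
  is_overring R V /\ is_valuation_ring V.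

Definition valuative_dim_eq (R : K -> Prop) (n : nat) : Prop :=
  (exists V, is_valuation_overring R V /\ has_prime_chain V n) /\
  (forall V, is_valuation_overring R V -> ~ has_prime_chain V n.+1).

Definition jaffard (R : K -> Prop) : Prop :=
  exists n, valuative_dim_eq R n /\ krull_dim_eq R n.

End SubringsOfField.

(* dim R1 = 1 + dim R2, as an equality in nat \cup {oo}
   (R1, R2 may live in different fields) *)
Definition dim_eq_succ (K1 K2 : fieldType) (R1 : K1 -> Prop) (R2 : K2 -> Prop)
  : Prop :=
  forall n, has_prime_chain R1 n.+1 <-> has_prime_chain R2 n.

Local Notation "x %:F" := (@FracField.tofrac _ x) (format "x %:F").

Section Domains.
Variable D : idomainType.

Definition dom_D : {fraction D} -> Prop := fun x => exists d : D, x = d%:F.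

Definition dom_DX : {fraction {poly D}} -> Prop :=
  fun x => exists p : {poly D}, x = p%:F.

Definition dom_DX_loc (S : {poly D} -> Prop) : {fraction {poly D}} -> Prop :=
  fun x => exists (p s : {poly D}), S s /\ x = p%:F / s%:F.

Definition polysA : {poly D} -> Prop := fun f => f.[0] = 1.
Definition polysU : {poly D} -> Prop := fun f => f \is monic.
Definition content_ideal (f : {poly D}) : D -> Prop :=
  fun d => exists a : nat -> D, d = \sum_(i < size f) a i * f`_i.
Definition polysN : {poly D} -> Prop := fun f => forall d, content_ideal f d.

End Domains.

Arguments dom_D D : clear implicits.
Arguments dom_DX D : clear implicits.
Arguments polysA D : clear implicits.
Arguments polysU D : clear implicits.
Arguments polysN D : clear implicits.

(* Main.v *)
Require Import Defs.
From mathcomp Require Import all_boot all_order all_algebra fraction.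
From HB Require Import structures.
From mathcomp Require Import boolp ring zify.
From mathcomp Require classical_sets.

Set Implicit Arguments. Unset Strict Implicit. Unset Printing Implicit Defensive.
Import Order.TTheory GRing.Theory Num.Theory.
Local Open Scope ring_scope.

(** Say that [v(R) >= n] when some overring of [R] has a chain of [n + 1]
    primes; by Chevalley's extension theorem and composition of valuations, the
    valuation overrings of [R] give the same bound.  The theorem follows from
    the cycle
      [v(D) >= n -> v(D[X]_N) >= n -> v(D[X]_U) >= n -> v(D[X]_A) >= n + 1
       -> v(D[X]) >= n + 1 -> v(D) >= n]
    together with its first four steps for Krull dimension; the fifth step for
    Krull dimension is the hypothesis [dim D[X] = 1 + dim D].
    - The first step localizes [R[X]] at the complement of [P_n[X]].
    - The third step rests on the fact that the automorphism [X |-> 1/X] maps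
      [D[X]_U] to the localization of [D[X]_A] at [X], where [X] lies in the
      Jacobson radical of [D[X]_A]: a prime not containing [X] is not maximal.
    - The last step is the inequality [rank W <= rank (W /\ K) + 1] for a
      valuation ring [W] of [K(X)]. *)

(** * Overrings, localizations and valuation rings *)

(** Arbitrary overrings are easier to produce than valuation overrings: a localization, or a subring
    plus an ideal, is enough. Valuation rings matter for [v] only in the step from [D[X]] back to
    [D], where every overring is first replaced by one. Since the cycle returns to its start, its
    implications are equivalences, so [v] grows by exactly 1 for [D[X]] and [D[X]_A] and by 0 for
    [D[X]_U] and [D[X]_N]. For Krull dimension the cycle does not close by itself, because a chain
    in [D[X]] may have two primes over each prime of [D]; this is why the dimension formula appears
    in conditions (2) to (5). Dimensions are handled as lower bounds, that is, as existence of
    chains, so infinite dimensions need no separate case. *)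

Section Subrings.
Variable K : fieldType.
Implicit Types (R T W P I J B S : K -> Prop).

Lemma subring0 R : is_subring R -> R 0.
Proof. by case=> R1 RB _; rewrite -(subrr 1); apply: RB. Qed.

Lemma subringN R x : is_subring R -> R x -> R (- x).
Proof. by move=> sR Rx; rewrite -sub0r; case: (sR) => _ RB _; apply: RB => //; apply: subring0. Qed.

Lemma subringD R x y : is_subring R -> R x -> R y -> R (x + y).
Proof.
by move=> sR Rx Ry; rewrite -[y]opprK; case: (sR) => _ RB _; apply: RB => //; apply: subringN.
Qed.

Lemma subringX R x n : is_subring R -> R x -> R (x ^+ n).
Proof.
by case=> R1 _ RM Rx; elim: n => [|n IHn]; rewrite ?expr0 // exprS; apply: RM.
Qed.

Lemma subring_sum R (I : Type) (r : seq I) (Q : pred I) (F : I -> K) :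
  is_subring R -> (forall i, Q i -> R (F i)) -> R (\sum_(i <- r | Q i) F i).
Proof.
by move=> sR RF; apply: big_ind => //; [apply: subring0 | move=> x y; apply: subringD].
Qed.

Lemma idealN R I x : is_subring R -> is_ideal R I -> I x -> I (- x).
Proof. by move=> sR [_ _ _ IM] Ix; rewrite -mulN1r; apply: IM => //; apply: subringN => //; case: sR. Qed.

Lemma idealB R I x y : is_subring R -> is_ideal R I -> I x -> I y -> I (x - y).
Proof. by move=> sR iI Ix Iy; case: (iI) => _ _ ID _; apply: ID => //; apply: (idealN sR iI). Qed.

Lemma ideal_sum R I (A : Type) (r : seq A) (Q : pred A) (F : A -> K) :
  is_ideal R I -> (forall i, Q i -> I (F i)) -> I (\sum_(i <- r | Q i) F i).
Proof. by case=> _ I0 ID _ IF; apply: big_ind. Qed.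

Lemma ideal_self R : is_subring R -> is_ideal R R.
Proof.
by move=> sR; split=> //; [apply: subring0 | move=> x y; apply: subringD | case: sR].
Qed.

Lemma prime_chain_leq R m n : (m <= n)%N -> has_prime_chain R n -> has_prime_chain R m.
Proof.
move=> mn [P [Pp Pi]]; exists P; split=> i im; first by apply: Pp; apply: leq_trans mn.
by apply: Pi; apply: leq_trans mn.
Qed.

Definition overring_chain R n := exists T, is_overring R T /\ has_prime_chain T n.

Lemma overring_chain_leq R m n : (m <= n)%N -> overring_chain R n -> overring_chain R m.
Proof. by move=> mn [T [oT cT]]; exists T; split=> //; apply: prime_chain_leq cT. Qed.

Lemma overring_chain_self R n : is_subring R -> has_prime_chain R n -> overring_chain R n.
Proof. by move=> sR cR; exists R. Qed.

Lemma overring_chain_sub R T n :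
  (forall x, R x -> T x) -> overring_chain T n -> overring_chain R n.
Proof. by move=> RT [S [[sS TS] cS]]; exists S; do !split=> //; move=> x /RT /TS. Qed.

(** * Localization inside the ambient field, for rings and ideals alike *)

Definition loc I S : K -> Prop := fun x => exists a s, [/\ I a, S s & x = a / s].

Definition mult_set B S := [/\ forall s, S s -> B s /\ s != 0, S 1
  & forall s t, S s -> S t -> S (s * t)].

Lemma loc_sub B I S x : mult_set B S -> I x -> loc I S x.
Proof. by case=> _ S1 _ Ix; exists x, 1; rewrite divr1. Qed.

Lemma loc_subring B S : is_subring B -> mult_set B S -> is_subring (loc B S).
Proof.
move=> sB mS; case: (sB) (mS) => B1 BB BM [S0 S1 SM]; split; first exact: loc_sub mS _.
- move=> _ _ [a [s [Ba Ss ->]]] [b [t [Bb St ->]]]; have [[Bs s0] [Bt t0]] := (S0 _ Ss, S0 _ St).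
  exists (a * t - b * s), (s * t); split; [by apply: BB; apply: BM | exact: SM |].
  by field; rewrite s0 t0.
- move=> _ _ [a [s [Ba Ss ->]]] [b [t [Bb St ->]]]; have [[Bs s0] [Bt t0]] := (S0 _ Ss, S0 _ St).
  exists (a * b), (s * t); split; [exact: BM | exact: SM |].
  by field; rewrite s0 t0.
Qed.

Lemma loc_ideal B I S : is_subring B -> mult_set B S -> is_ideal B I ->
  is_ideal (loc B S) (loc I S).
Proof.
move=> sB mS [IB I0 ID IM]; case: (mS) => S0 S1 SM; split.
- by move=> x [a [s [Ia Ss ->]]]; exists a, s; split=> //; apply: IB.
- exact: loc_sub mS _.
- move=> _ _ [a [s [Ia Ss ->]]] [b [t [Ib St ->]]]; have [[Bs s0] [Bt t0]] := (S0 _ Ss, S0 _ St).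
  exists (t * a + s * b), (s * t); split; [by apply: ID; apply: IM | exact: SM |].
  by field; rewrite s0 t0.
- move=> _ _ [a [s [Ba Ss ->]]] [b [t [Ib St ->]]]; have [[Bs s0] [Bt t0]] := (S0 _ Ss, S0 _ St).
  exists (a * b), (s * t); split; [exact: IM | exact: SM |].
  by field; rewrite s0 t0.
Qed.

Lemma loc_contract B P S x : is_prime_ideal B P -> mult_set B S ->
  (forall s, S s -> ~ P s) -> B x -> loc P S x <-> P x.
Proof.
case=> -[PB P0 PD PM] P1 Pp mS nPS Bx; case: (mS) => S0 S1 SM.
split; last exact: loc_sub mS.
move=> [a [s [Pa Ss e]]]; have [Bs s0] := S0 _ Ss.
have : P (x * s) by rewrite e divfK.
by case/Pp => // /(nPS _ Ss).
Qed.

Lemma loc_prime B P S : is_subring B -> is_prime_ideal B P -> mult_set B S ->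
  (forall s, S s -> ~ P s) -> is_prime_ideal (loc B S) (loc P S).
Proof.
move=> sB pP mS nPS; case: (pP) (mS) (sB) => iP P1 Pp [S0 S1 SM] [B1 _ BM].
split; first exact: loc_ideal.
  by move/(loc_contract pP mS nPS B1).
move=> _ _ [a [s [Ba Ss ->]]] [b [t [Bb St ->]]] [c [u [Pc Su e]]].
have [[[Bs s0] [Bt t0]] [Bu u0]] := (S0 _ Ss, S0 _ St, S0 _ Su).
have : P (a * b * u).
  have -> : a * b * u = (s * t) * c.
    have -> : c = a / s * (b / t) * u by rewrite e divfK.
    by field; rewrite s0 t0.
  by case: iP => _ _ _; apply=> //; apply: BM.
case/Pp => //; [exact: BM | move=> /Pp[]// Pab | by move/(nPS _ Su)].
  by left; exists a, s.
by right; exists b, t.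
Qed.

Lemma prime_compl_mult_set B P : is_subring B -> is_prime_ideal B P ->
  mult_set B (fun s => B s /\ ~ P s).
Proof.
move=> [B1 _ BM] [[_ P0 _ _] P1 Pp]; split=> [s [Bs nPs]|//|s t [Bs nPs] [Bt nPt]].
  by split=> //; apply/eqP => s0; apply: nPs; rewrite s0.
by split; [apply: BM | case/Pp].
Qed.

Lemma prime_chain_mono n (P : nat -> K -> Prop) :
  (forall i, (i < n)%N -> forall x, P i x -> P i.+1 x) ->
  forall i j x, (i <= j <= n)%N -> P i x -> P j x.
Proof.
move=> PS i j x /andP[]; elim: j => [|j IHj]; first by rewrite leqn0 => /eqP ->.
by rewrite leq_eqVlt => /predU1P[-> //|ij jn Pi]; apply: PS => //; apply: IHj => //; apply: ltnW.
Qed.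

(** Taking the intersection of the ideals of [W] that contain [P] avoids finite sums. It is
    meaningful for [P] inside [W]; otherwise no [J] qualifies. *)
Definition generated_ideal P W : K -> Prop :=
  fun x => forall J, is_ideal W J -> (forall p, P p -> J p) -> J x.

Lemma generated_is_ideal P W : is_subring W -> (forall p, P p -> W p) ->
  is_ideal W (generated_ideal P W).
Proof.
move=> sW PW; split=> [x|J [] //|x y gx gy J iJ PJ|r x Wr gx J iJ PJ].
- by apply=> //; apply: ideal_self.
- by case: (iJ) => _ _ JD _; apply: JD; [apply: gx | apply: gy].
- by case: (iJ) => _ _ _ JM; apply: JM => //; apply: gx.
Qed.

Lemma generated_self P W p : P p -> generated_ideal P W p.
Proof. by move=> Pp J _; apply. Qed.

(** An ideal of [W'] containing [P] meets [W] in an ideal of [W] containing [P]. *)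
Lemma generatedS P W W' x : is_subring W -> (forall p, P p -> W p) ->
  (forall y, W y -> W' y) -> generated_ideal P W x -> generated_ideal P W' x.
Proof.
move=> sW PW WW' gx J [JW J0 JD JM] PJ.
suff [] : W x /\ J x by [].
apply: (gx (fun y => W y /\ J y)); last by move=> p Pp; split; auto.
split=> [y []//||y z [Wy Jy] [Wz Jz]|r y Wr [Wy Jy]].
- by split=> //; apply: subring0.
- by split; [apply: subringD | apply: JD].
- by split; [case: sW => _ _; apply | apply: JM; auto].
Qed.

(** * Extensions by one element, and relations of bounded degree *)

Definition adjoin R x : K -> Prop :=
  fun z => exists2 q : {poly K}, (forall i, R q`_i) & z = q.[x].

Lemma adjoin_sub R x z : is_subring R -> R z -> adjoin R x z.
Proof.
move=> sR Rz; exists z%:P; last by rewrite hornerC.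
by move=> i; rewrite coefC; case: eqP => // _; apply: subring0.
Qed.

Lemma adjoin_gen R x : is_subring R -> adjoin R x x.
Proof.
move=> sR; exists 'X; last by rewrite hornerX.
by move=> i; rewrite coefX; case: eqP => _; [case: sR | apply: subring0].
Qed.

Lemma adjoin_subring R x : is_subring R -> is_subring (adjoin R x).
Proof.
move=> sR; case: (sR) => R1 RB RM; split.
- exact: adjoin_sub.
- by move=> _ _ [p Rp ->] [q Rq ->]; exists (p - q) => [i|]; rewrite ?coefB ?hornerE //; apply: RB.
- move=> _ _ [p Rp ->] [q Rq ->]; exists (p * q) => [i|]; last by rewrite hornerM.
  by rewrite coefM; apply: subring_sum => // j _; apply: RM.
Qed.

(** With coefficients restricted to [I], [adjoin] gives the extended ideal [I R[x]]. *)
Lemma adjoin_ideal R I x : is_subring R -> is_ideal R I -> is_ideal (adjoin R x) (adjoin I x).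
Proof.
move=> sR [IR I0 ID IM]; split.
- by move=> _ [q Iq ->]; exists q => // i; apply: IR.
- by exists 0 => [i|]; rewrite ?coef0 ?horner0.
- by move=> _ _ [p Rp ->] [q Rq ->]; exists (p + q) => [i|]; rewrite ?coefD ?hornerE //; apply: ID.
- move=> _ _ [p Rp ->] [q Rq ->]; exists (p * q) => [i|]; last by rewrite hornerM.
  by rewrite coefM; apply: (@ideal_sum R I) => // j _; apply: IM.
Qed.

(** [n] counts coefficients, so the degree in [x] is less than [n], and [n = 0] leaves only the
    value 0. *)
Definition poly_span I x n : K -> Prop :=
  fun z => exists2 a : nat -> K, (forall i, I (a i)) & z = \sum_(i < n) a i * x ^+ i.

Lemma adjoin_span I x z : adjoin I x z -> exists n, poly_span I x n z.
Proof. by case=> q Iq ->; exists (size q), (fun i => q`_i) => //; rewrite horner_coef. Qed.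

Lemma poly_spanD R I x n y z : is_ideal R I ->
  poly_span I x n y -> poly_span I x n z -> poly_span I x n (y + z).
Proof.
case=> _ _ ID _ [a Ia ->] [b Ib ->]; exists (fun i => a i + b i) => [i|]; first exact: ID.
by rewrite -big_split; apply: eq_bigr => i _; rewrite mulrDl.
Qed.

Lemma poly_spanX R I x n i c : is_ideal R I -> (i < n)%N -> I c -> poly_span I x n (c * x ^+ i).
Proof.
case=> _ I0 _ _ ltin Ic; exists (fun j => if j == i then c else 0); first by move=> j; case: eqP.
rewrite (bigD1 (Ordinal ltin)) //= eqxx big1 ?addr0 // => j /eqP neji.
by case: eqP => [eji|]; rewrite ?mul0r //; case: neji; apply: val_inj.
Qed.

Lemma poly_span_sum R I x n m (F : 'I_m -> K) : is_ideal R I ->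
  (forall i, poly_span I x n (F i)) -> poly_span I x n (\sum_(i < m) F i).
Proof.
move=> iI SF; apply: big_ind => // [|y z]; last exact: (poly_spanD iI).
by exists (fun=> 0) => [_|]; [case: iI | rewrite big1 // => i _; rewrite mul0r].
Qed.

(** The relation in [x^-1] expresses the unit [1 - b_0] by negative powers of [x]. Multiplied by
    [a_n x^n / (1 - b_0)], it rewrites the leading term of the relation in [x] by lower powers;
    [m <= n] keeps the exponents nonnegative. *)
Lemma poly_span_reduce R I x n m :
  is_subring R -> is_ideal R I -> (forall j, I j -> R (1 - j)^-1 /\ 1 - j != 0) ->
  x != 0 -> (m <= n)%N ->
  poly_span I x n.+1 1 -> poly_span I x^-1 m.+1 1 -> poly_span I x n 1.
Proof.
move=> sR iI units x0 mn [a Ia ea] [b Ib eb]; case: (iI) => IR _ _ IM.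
rewrite big_ord_recr /= in ea; rewrite big_ord_recl /= expr0 mulr1 in eb.
have [Ru u0] := units _ (Ib 0%N).
rewrite ea; apply: poly_spanD (iI) _ _.
  by apply: (@poly_span_sum R) => // i; apply: (@poly_spanX R) => //; apply: leq_trans (ltn_ord i) _.
have -> : a n * x ^+ n = \sum_(i < m) (a n * (b i.+1 / (1 - b 0%N))) * x ^+ (n - i.+1).
  have -> : a n * x ^+ n = a n / (1 - b 0%N) * x ^+ n * (1 - b 0%N) by field.
  have e0 : 1 - b 0%N = \sum_(i < m) b (bump 0 i) * x^-1 ^+ bump 0 i.
    by rewrite {1}eb addrAC subrr add0r.
  rewrite [X in _ * X = _]e0 mulr_sumr; apply: eq_bigr => i _.
  have le : (i.+1 <= n)%N by apply: leq_trans (ltn_ord i) mn.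
  rewrite /bump /= add1n expfB_cond ?exprVn; last by rewrite (negPf x0).
  by field; rewrite u0 expf_neq0.
apply: (@poly_span_sum R) => // i; apply: (@poly_spanX R) => //; first by have := ltn_ord i; lia.
by apply: (IM _ _ (IR _ (Ia n))); rewrite mulrC; apply: IM.
Qed.

(** Descent on [n + m]: the relation of larger degree can always be shortened, [x] and [x^-1]
    playing symmetric roles, until one of them reads [1 = 0]. *)
Lemma poly_span_absurd R I x n m :
  is_subring R -> is_ideal R I -> (forall j, I j -> R (1 - j)^-1 /\ 1 - j != 0) ->
  x != 0 -> poly_span I x n 1 -> poly_span I x^-1 m 1 -> False.
Proof.
move=> sR iI units x0.
have span0 y : poly_span I y 0 1 -> False.
  by case=> a _; rewrite big_ord0 => /eqP; rewrite oner_eq0.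
have [N] := ubnP (n + m); elim: N n m => // N IHN [|n] [|m] ltN; try by move=> *; eauto.
move=> Sx Sy; case: (leqP m n) => mn.
  by apply: (IHN n m.+1) => //; apply: (@poly_span_reduce R I x n m).
apply: (IHN n.+1 m) => //; first lia.
by apply: (@poly_span_reduce R I x^-1 m n) => //; [rewrite invr_eq0 | lia | rewrite invrK].
Qed.

(* Kaplansky's form of Chevalley's extension theorem: a subring maximal for
   not having [1] in the ideal generated by [P] is a valuation ring. *)
Lemma valuation_ring_avoiding T P : is_subring T -> (forall p, P p -> T p) ->
  ~ generated_ideal P T 1 ->
  exists W, [/\ is_valuation_overring T W & ~ generated_ideal P W 1].
Proof.
move=> sT PT T1.
(* [Zorn_bigcup] also asks about the empty chain, whose union is empty; adjoining [T] to every
   candidate turns that union into the admissible ring [T]. *)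
pose cl (A : K -> Prop) x := A x \/ T x.
pose good W := [/\ is_subring W, (forall x, T x -> W x) & ~ generated_ideal P W 1].
have [|A [gA maxA]] := @classical_sets.Zorn_bigcup K (fun A => good (cl A)).
  move=> F gF totF; set U := cl _.
  (* The empty set, which stands for [T], joins the chain so that every element of [U], including
     those of [T], lies in a member. *)
  pose in_chain Z := F Z \/ Z = (fun=> False).
  have gZ Z : in_chain Z -> good (cl Z).
    case=> [/gF //|->]; have -> // : cl (fun=> False) = T.
    by apply: funext => x; rewrite propeqE; split=> [[]|] //; right.
  have ZU Z x : in_chain Z -> cl Z x -> U x.
    by case=> [FZ|->] [Zx|Tx]; by [right | left; exists Z].
  have UZ x : U x -> exists2 Z, in_chain Z & cl Z x.
    by case=> [[Z FZ Zx]|Tx]; [exists Z => //; left | exists (fun=> False) => //; right].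
  have tot Z1 Z2 : in_chain Z1 -> in_chain Z2 ->
      exists Z, [/\ in_chain Z, (forall x, cl Z1 x -> cl Z x) & (forall x, cl Z2 x -> cl Z x)].
    have cl0 Z x : cl (fun=> False) x -> cl Z x by case=> // Tx; right.
    have clS Z Z' x : (forall x, Z x -> Z' x) -> cl Z x -> cl Z' x.
      by move=> ZZ' [Zx|Tx]; [left; apply: ZZ' | right].
    case=> [F1|->] c2; last by exists Z2; split=> // x; apply: cl0.
    case: c2 => [F2|->]; last by exists Z1; split=> [|//|x]; [left | apply: cl0].
    by case: (totF _ _ F1 F2) => S; [exists Z2 | exists Z1]; split=> [|x|x] //;
      try (by left); apply: clS.
  have UZ2 x y : U x -> U y -> exists Z, [/\ in_chain Z, cl Z x & cl Z y].
    move=> /UZ[Z1 c1 x1] /UZ[Z2 c2 y2]; have [Z [cZ s1 s2]] := tot _ _ c1 c2.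
    by exists Z; split; auto.
  have sU : is_subring U; first split.
  - by right; case: sT.
  - move=> x y /UZ2/[apply]-[Z [cZ Zx Zy]]; apply: (ZU Z) => //.
    by have [[_ sB _] _ _] := gZ _ cZ; apply: sB.
  - move=> x y /UZ2/[apply]-[Z [cZ Zx Zy]]; apply: (ZU Z) => //.
    by have [[_ _ sM] _ _] := gZ _ cZ; apply: sM.
  split=> [//|x Tx|]; first by right.
  have gen_ideal Z : in_chain Z -> is_ideal (cl Z) (generated_ideal P (cl Z)).
    by move=> cZ; have [sZ TZ _] := gZ _ cZ; apply: generated_is_ideal => // p /PT/TZ.
  have genS Z Z' x : in_chain Z -> in_chain Z' -> (forall x, cl Z x -> cl Z' x) ->
      generated_ideal P (cl Z) x -> generated_ideal P (cl Z') x.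
    by move=> cZ _ ZZ'; have [sZ TZ _] := gZ _ cZ; apply: generatedS => // p /PT/TZ.
  (* The union of the ideals generated in the members of the chain is an ideal of [U]; if it
     contains 1, so does one of them. *)
  move/(_ (fun x => exists2 Z, in_chain Z & generated_ideal P (cl Z) x)) => [||Z cZ].
  - split.
    + by move=> x [Z cZ gx]; apply: (ZU Z) => //; case: (gen_ideal _ cZ) => + _ _ _; apply.
    + exists (fun=> False); first by right.
      by have [] := gen_ideal (fun=> False) (or_intror erefl).
    + move=> x y [Z1 c1 g1] [Z2 c2 g2]; have [Z [cZ s1 s2]] := tot _ _ c1 c2.
      exists Z => //; have [_ _ + _] := gen_ideal _ cZ; apply.
        exact: genS s1 g1.
      exact: genS s2 g2.
    + move=> r x /UZ[Z1 c1 r1] [Z2 c2 g2]; have [Z [cZ s1 s2]] := tot _ _ c1 c2.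
      exists Z => //; have [_ _ _] := gen_ideal _ cZ; apply; first exact: s1.
      exact: genS s2 g2.
  - by move=> p Pp; exists (fun=> False); [right | apply: generated_self].
  - by have [_ _] := gZ _ cZ.
have {maxA} maxW W x : good W -> (forall y, cl A y -> W y) -> W x -> cl A x.
  move=> gW AW Wx; apply: contrapT => nAx; apply: (maxA W).
    by split=> [y Ay|/(_ _ Wx) Ax]; [apply: AW; left | apply: nAx; left].
  have -> // : cl W = W.
  by apply: funext => y; rewrite propeqE; split=> [[//|Ty]|]; [case: gW => _ + _; apply | left].
set W := cl A in gA maxW; case: (gA) => sW TW W1.
have PW p : P p -> W p by move/PT/TW.
set J := generated_ideal P W; have iJ : is_ideal W J by apply: generated_is_ideal.
(* For [x] outside [W], the ring [W[x]] is strictly larger, so by maximality [P] generates the unit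
   ideal there: 1 is a polynomial in [x] with coefficients in [J]. *)
have escape x : ~ W x -> exists n, poly_span J x n 1.
  move=> nWx; apply: adjoin_span; apply: contrapT => n1; apply: nWx.
  apply: (maxW (adjoin W x)); [|by move=> y; apply: adjoin_sub | exact: adjoin_gen].
  split=> [|y /TW|]; [exact: adjoin_subring | exact: adjoin_sub|].
  move/(_ _ (adjoin_ideal x sW iJ)) => g1; apply: n1; apply: g1 => p Pp.
  have Jp : J p by apply: generated_self.
  exists p%:P; rewrite ?hornerC // => i; rewrite coefC; case: ifP => // _; by case: iJ.
(* If [(1 - j)^-1] were outside [W], clearing denominators in its relation would put [(1 - j)^n]
   into [J]; this power is congruent to 1 modulo [j], so 1 would be in [J]. *)
have units j : J j -> W (1 - j)^-1 /\ 1 - j != 0.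
  move=> Jj; case: (iJ) => JW J0 JD JM.
  have u0 : 1 - j != 0 by apply/negP; rewrite subr_eq0 => /eqP j1; apply: W1; rewrite j1.
  split=> //; apply: contrapT => /escape[n [a Ja e1]].
  have Wu : W (1 - j) by case: (sW) => ? WB _; apply: WB => //; apply: JW.
  have Jun : J ((1 - j) ^+ n).
    rewrite -[_ ^+ n]mulr1 [X in _ * X]e1 mulr_sumr; apply: (@ideal_sum W J) => // i _.
    rewrite mulrCA mulrC; apply: JM => //.
    have -> : (1 - j) ^+ n * (1 - j)^-1 ^+ i = (1 - j) ^+ (n - i).
      by rewrite exprVn expfB_cond // (negPf u0) add0n ltnW.
    exact: subringX.
  apply: W1; have [k] : exists k, (1 - j) ^+ n = 1 - j * k /\ W k.
    elim: (n) => [|m [k [e Wk]]]; first by exists 0; rewrite mulr0 subr0 expr0; split=> //; apply: subring0.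
    exists (1 + k - j * k); split; first by rewrite exprS e; ring.
    by case: (sW) => ? WB WM; apply: WB; [apply: subringD | apply: WM => //; apply: JW].
  case=> e Wk; rewrite -(subrK (j * k) 1) -e; apply: JD => //; rewrite mulrC; exact: JM.
exists W; split=> //; split=> // x x0.
apply: contrapT => /not_orP[/escape[n Sx] /escape[m Sy]].
exact: (poly_span_absurd sW iJ units x0 Sx Sy).
Qed.

(** By convention [0^-1 = 0], which lies in [W], so zero has to be listed separately. For a
    valuation ring, membership in [W] follows. *)
Definition nonunits W : K -> Prop := fun x => x = 0 \/ ~ W x^-1.

Lemma nonunits_prime W : is_subring W -> is_valuation_ring W -> is_prime_ideal W (nonunits W).
Proof.
move=> sW vW; case: (sW) => W1 WB WM.
have sub x : nonunits W x -> W x.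
  case=> [->|nx]; first exact: subring0.
  have [->|x0] := eqVneq x 0; first exact: subring0.
  by case: (vW _ x0).
have mul r x : W r -> nonunits W x -> nonunits W (r * x).
  move=> Wr [->|nx]; first by left; rewrite mulr0.
  have [->|x0] := eqVneq x 0; first by left; rewrite mulr0.
  have [->|r0] := eqVneq r 0; first by left; rewrite mul0r.
  by right=> Wrx; apply: nx; rewrite (_ : x^-1 = r * (r * x)^-1); [apply: WM | field; rewrite r0 x0].
split.
- split=> //; first by left.
  have add x y : y != 0 -> nonunits W y -> W (x / y) -> nonunits W (x + y).
    move=> y0 ny Wxy; rewrite (_ : x + y = (x / y + 1) * y); last by field.
    by apply: mul => //; apply: subringD.
  move=> x y nx ny; have [->|x0] := eqVneq x 0; first by rewrite add0r.
  have [->|y0] := eqVneq y 0; first by rewrite addr0.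
  have /vW[|] : x / y != 0 by rewrite mulf_neq0 ?invr_eq0.
    exact: add.
  by rewrite invf_div addrC; apply: add.
- by case=> [/eqP|]; rewrite ?oner_eq0 // invr1.
- move=> a b Wa Wb [/eqP|]; first by rewrite mulf_eq0 => /orP[]/eqP->; [left|right]; left.
  rewrite invfM => nab; apply: contrapT => /not_orP[/not_orP[_ /contrapT Wa'] /not_orP[_ /contrapT Wb']].
  by apply: nab; apply: WM.
Qed.

(** Localizing at [P] beforehand makes the elements of [T] outside [P] units of [W], so the center
    is [P] itself and not a larger prime. *)
Lemma valuation_ring_centered T P : is_subring T -> is_prime_ideal T P ->
  exists W, is_valuation_overring T W /\ (forall x, T x -> nonunits W x <-> P x).
Proof.
move=> sT pP; have [[PT P0 PD PM] P1 _] := pP; have [T1 _ _] := sT.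
have mS := prime_compl_mult_set sT pP; set S := (fun s => _) in mS.
have nPS s : S s -> ~ P s by case.
have T_frac I x : I x -> loc I S x by apply: loc_sub mS.
have [||W [[[sW FW] vW] nW1]] := @valuation_ring_avoiding (loc T S) P (loc_subring sT mS).
- by move=> p /PT; apply: T_frac.
- case: (pP) => iP _ _ /(_ _ (loc_ideal sT mS iP) (T_frac P)).
  by move/(loc_contract pP mS nPS T1).
exists W; split; first by do !split=> //; move=> x Tx; apply: FW; apply: T_frac.
move=> x Tx; split=> [nx|Px].
  apply: contrapT => nPx; case: nx => [x0|]; first by apply: nPx; rewrite x0.
  by case; apply: FW; exists 1, x; rewrite mul1r.
have [->|x0] := eqVneq x 0; [by left | right=> Wx; apply: nW1].
have [|_ _ _ gM] := @generated_is_ideal P W sW; first by move=> p /PT Tp; apply/FW/T_frac.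
by rewrite -(mulVf x0); apply: gM => //; apply: generated_self.
Qed.

(* Valuation rings [W_0 > W_1 > ... > W_k] centered on the successive primes are
   obtained by composition: [W_(k+1)] is centered on [P_(k+1) + m(W_k)] in
   [T + m(W_k)]. *)
Lemma valuation_overring_chain T n : is_subring T -> has_prime_chain T n ->
  exists W, is_valuation_overring T W /\ has_prime_chain W n.
Proof.
move=> sT [P [Pp Plt]]; case: (sT) => T1 TB TM.
have build k : (k <= n)%N -> exists W Q, [/\ is_valuation_overring T W,
    (forall i, (i <= k)%N -> is_prime_ideal W (Q i) /\ forall x, T x -> Q i x <-> P i x),
    (forall x, Q k x <-> nonunits W x),
    (forall i, (i <= k)%N -> forall x, Q i x -> nonunits W x)
    & forall i, (i < k)%N -> forall x, Q i x -> Q i.+1 x].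
  elim: k => [|k IHk] kn.
    have [W [oW eW]] := valuation_ring_centered sT (Pp _ kn).
    exists W, (fun=> nonunits W); split=> // i; rewrite leqn0 => /eqP ->.
    by split=> //; case: oW => -[sW _] vW; apply: nonunits_prime.
  have [W [Q [[[sW TW] vW] QP Qk QM QQ]]] := IHk (ltnW kn).
  set M := nonunits W.
  have pM : is_prime_ideal W M := nonunits_prime sW vW.
  have [[MW M0 MD MM] M1 _] := pM.
  have MB x y : M x -> M y -> M (x - y) by apply: (idealB sW); case: pM.
  (* [M] restricts to [P k] on [T], and [P k] lies in [P k.+1]. Hence whether [t] is in [P k.+1]
     does not depend on the decomposition of an element of [T + M] as [t + m]. *)
  have MP x : T x -> M x -> P k.+1 x.
    move=> Tx /Qk Mx; have [PkS _] := Plt _ kn; apply: PkS.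
    by have [_] := QP k (leqnn k); move/(_ _ Tx) => <-.
  pose plus I x := exists2 t, I t & M (x - t).
  have inc I x : I x -> plus I x by move=> Ix; exists x; rewrite ?subrr.
  have [[PT P0 PD PM] P1 PpM] := Pp _ kn.
  have PB := idealB sT (And4 PT P0 PD PM).
  have mulM x y a b : W x -> T b -> M (x - a) -> M (y - b) -> M (x * y - a * b).
    move=> Wx Tb Mx My; rewrite (_ : _ - _ = x * (y - b) + b * (x - a)); last by ring.
    by apply: MD; apply: MM => //; apply: TW.
  have pW x : plus T x -> W x.
    by case=> t Tt Mxt; rewrite -(subrK t x); apply: subringD => //; [apply: MW | apply: TW].
  have sT' : is_subring (plus T).
    split; first exact: inc.
      move=> x y [a Ta Ma] [b Tb Mb]; exists (a - b); first exact: TB.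
      by rewrite (_ : _ - _ = (x - a) - (y - b)); [apply: MB | ring].
    move=> x y [a Ta Ma] [b Tb Mb]; exists (a * b); first exact: TM.
    by apply: mulM => //; apply: pW; exists a.
  have pP' : is_prime_ideal (plus T) (plus (P k.+1)).
    split.
    - split; last 3 first.
      + exact: inc.
      + move=> x y [a Ta Ma] [b Tb Mb]; exists (a + b); first exact: PD.
        by rewrite (_ : _ - _ = (x - a) + (y - b)); [apply: MD | ring].
      + move=> x y [a Ta Ma] [b Tb Mb]; exists (a * b); first exact: PM.
        by apply: mulM => //; [apply: pW; exists a | apply: PT].
      + by move=> x [t Pt Mt]; exists t => //; apply: PT.
    - case=> t Pt Mt; apply: P1; rewrite -(subrK t 1); apply: PD => //; apply: MP => //.
      by apply: TB => //; apply: PT.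
    - move=> x y [a Ta Ma] [b Tb Mb] [t Pt Mt].
      have : P k.+1 (a * b).
        rewrite -(subrK t (a * b)); apply: PD => //; apply: MP; first by apply: TB; [apply: TM | apply: PT].
        rewrite (_ : _ - _ = (x * y - t) - (x * y - a * b)); last by ring.
        by apply: MB => //; apply: mulM => //; apply: pW; exists a.
      by case/PpM => // Pab; [left; exists a | right; exists b].
  have [W' [[[sW' TW'] vW'] eW']] := valuation_ring_centered sT' pP'.
  have MW' x : M x -> nonunits W' x.
    move=> Mx; have Mx0 : M (x - 0) by rewrite subr0.
    by apply/eW'; exists 0 => //; apply: subring0.
  (* An element outside [W] has its inverse in [M], hence among the nonunits of [W'], so it is
     outside [W'] too. *)
  have W'W x : W' x -> W x.
    move=> W'x; have [->|x0] := eqVneq x 0; first exact: subring0.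
    apply: contrapT => nWx; have /MW' : M x^-1 by right; rewrite invrK.
    by case=> [/eqP|]; rewrite ?invr_eq0 ?invrK // (negPf x0).
  have W'M x : nonunits W' x -> W' x by have [[+ _ _ _] _ _] := nonunits_prime sW' vW'; apply.
  (* The old primes survive: they lie in [M], hence in [W'], and what is closed under multiplication
     by [W] is closed under multiplication by the smaller ring [W']. *)
  exists W', (fun i => if (i <= k)%N then Q i else nonunits W'); split.
  - by do !split=> //; move=> x Tx; apply: TW'; apply: inc.
  - move=> i; rewrite leq_eqVlt ltnS => /orP[/eqP -> | ik].
      rewrite ltnn; split; first exact: nonunits_prime.
      move=> x Tx; rewrite (eW' _ (inc _ _ Tx)); split; last exact: inc.
      by case=> t Pt Mxt; rewrite -(subrK t x); apply: PD => //; apply: MP => //; apply: TB => //; apply: PT.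
    rewrite ik; have [[[QW Q0 QD QIM] Q1 Qp] eQ] := QP i ik; split=> //; split=> //.
      split=> // [x Qx|r x /W'W Wr Qx]; last exact: QIM.
      apply: W'M; apply: MW'; exact: QM ik _ Qx.
    by move=> a b /W'W Wa /W'W Wb; apply: Qp.
  - by move=> x; rewrite ltnn.
  - move=> i; rewrite leq_eqVlt ltnS => /orP[/eqP -> x|ik x]; first by rewrite ltnn.
    by rewrite ik => /(QM _ ik) /MW'.
  - move=> i; rewrite ltnS => ik x; rewrite ik; case: ltnP => ki; first exact: QQ.
    have -> : i = k by lia.
    by move/Qk; apply: MW'.
have [W [Q [oW QP _ _ QQ]]] := build n (leqnn n).
exists W; split=> //; exists Q; split=> i ltin; first by case: (QP i ltin).
split; first exact: QQ.
have [_ [x [Px nPx]]] := Plt i ltin.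
have Tx : T x by have [[PT _ _ _] _ _] := Pp _ ltin; apply: PT.
exists x; have [_ eQ] := QP _ ltin; have [_ eQ'] := QP _ (ltnW ltin).
by rewrite eQ // eQ'.
Qed.

End Subrings.

(** * Contracting and extending chains of primes *)

Section Contraction.
Variables (K1 K2 : fieldType) (phi : {rmorphism K1 -> K2}).
Variables (R1 : K1 -> Prop) (R2 : K2 -> Prop).
Hypotheses (sR1 : is_subring R1) (R12 : forall x, R1 x -> R2 (phi x)).

(** Stated along a morphism, so as to cover inclusions in one field, the embedding of a field in an
    extension, and automorphisms. *)
Lemma prime_contract P : is_prime_ideal R2 P ->
  is_prime_ideal R1 (fun x => R1 x /\ P (phi x)).
Proof.
case=> -[PR P0 PD PM] P1 Pp; case: (sR1) => _ _ RM; split; first split.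
- by move=> x [].
- by rewrite rmorph0; split=> //; apply: subring0.
- by move=> x y [Rx Px] [Ry Py]; rewrite rmorphD; split; [apply: subringD | apply: PD].
- by move=> r x Rr [Rx Px]; rewrite rmorphM; split; [apply: RM | apply: PM; auto].
- by rewrite rmorph1 => -[].
- by move=> a b Ra Rb []; rewrite rmorphM => Rab /Pp[|||]; auto.
Qed.

(** Contraction can merge primes, so strictness has to be witnessed by elements coming from [R1]. *)
Lemma chain_contract n (P : nat -> K2 -> Prop) :
  (forall i, (i <= n)%N -> is_prime_ideal R2 (P i)) ->
  (forall i, (i < n)%N -> forall x, P i x -> P i.+1 x) ->
  (forall i, (i < n)%N -> exists x, [/\ R1 x, P i.+1 (phi x) & ~ P i (phi x)]) ->
  has_prime_chain R1 n.
Proof.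
move=> Pp PS Plt; exists (fun i x => R1 x /\ P i (phi x)); split=> i ltin.
  by apply: prime_contract; apply: Pp.
split=> [x [Rx Px]|]; first by split=> //; apply: PS.
by have [x [Rx Px nPx]] := Plt i ltin; exists x; split=> // -[].
Qed.

End Contraction.

Section Enlarging.
Variable K : fieldType.
Implicit Types (B P I S T W : K -> Prop).

(** The maximal ideal of a valuation ring in which [I] does not generate 1 contracts to such a
    prime; no second appeal to Zorn's lemma is made. *)
Lemma prime_above T I : is_subring T -> is_ideal T I -> ~ I 1 ->
  exists P, is_prime_ideal T P /\ forall x, I x -> P x.
Proof.
move=> sT iI I1; have IT x : I x -> T x by case: iI => + _ _ _; apply.
have [|W [[[sW TW] vW] nW1]] := @valuation_ring_avoiding K T I sT IT.
  by move/(_ _ iI) => /(_ (fun _ => id)).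
exists (fun x => T x /\ nonunits W (idfun x)); split.
  exact: (@prime_contract K K idfun T W sT TW _ (nonunits_prime sW vW)).
move=> x Ix; split; first exact: IT.
have [->|x0] := eqVneq x 0; [by left | right=> Wx; apply: nW1].
have [|_ _ _ gM] := @generated_is_ideal K I W sW; first by move=> y /IT/TW.
by rewrite -(mulVf x0); apply: gM => //; apply: generated_self.
Qed.

(* The new prime lies over [Q_n + y T0]; this ideal is proper because
   [1 - y b] is never in [Q_n]. *)
Lemma enlarge_chain T T0 y n (Q : nat -> K -> Prop) :
  is_subring T -> is_subring T0 -> (forall x, T0 x -> T x) ->
  T0 y -> y != 0 -> T y^-1 ->
  (forall i, (i <= n)%N -> is_prime_ideal T (Q i)) ->
  (forall i, (i < n)%N -> forall x, Q i x -> Q i.+1 x) ->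
  (forall i, (i < n)%N -> exists x, [/\ T0 x, Q i.+1 x & ~ Q i x]) ->
  (forall x, T0 x -> exists b, [/\ Q n (x - b), 1 - y * b != 0 & T (1 - y * b)^-1]) ->
  has_prime_chain T0 n.+1.
Proof.
move=> sT sT0 T0T T0y y0 Ty Qp QS Qlt units.
have [[QT Q0 QD QM] Q1 _] := Qp n (leqnn n); case: (sT0) => _ _ T0M.
pose I z := exists q t, [/\ T0 q, Q n q, T0 t & z = q + y * t].
have iI : is_ideal T0 I.
  split.
  - by move=> _ [q [t [Tq _ Tt ->]]]; apply: subringD => //; apply: T0M.
  - by exists 0, 0; split; rewrite ?mulr0 ?addr0 //; apply: subring0.
  - move=> _ _ [q [t [Tq Qq Tt ->]]] [q' [t' [Tq' Qq' Tt' ->]]]; exists (q + q'), (t + t').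
    by split; [exact: subringD | exact: QD | exact: subringD | ring].
  - move=> r _ Tr [q [t [Tq Qq Tt ->]]]; exists (r * q), (r * t).
    by split; [exact: T0M | apply: QM; auto | exact: T0M | ring].
have nI1 : ~ I 1.
  case=> q [t [Tq Qq Tt e1]]; have [b [Qb u0 Tu]] := units _ Tt.
  apply: Q1; rewrite -(mulVf u0); apply: (QM) => //; rewrite {1}e1.
  rewrite (_ : _ - _ = q + y * (t - b)); last by ring.
  by apply: QD => //; apply: QM; auto.
have [P [pP IP]] := prime_above sT0 iI nI1.
exists (fun i x => if (i <= n)%N then T0 x /\ Q i x else P x); split=> i.
  rewrite /=; case: (boolP (i <= n)%N) => // lein _.
  by apply: (@prime_contract K K idfun T0 T sT0 T0T); apply: Qp.
rewrite ltnS => lein; rewrite /= lein; case: (ltnP i n) => [ltin|nlei].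
  split=> [x [Tx Qx]|]; first by split=> //; apply: QS.
  by have [x [Tx Qx nQx]] := Qlt i ltin; exists x; split=> // -[].
have -> : i = n by lia.
split=> [x [Tx Qx]|].
  by apply: IP; exists x, 0; rewrite mulr0 addr0; split=> //; apply: subring0.
(* The last inclusion is strict because [y] is a unit of [T] and so avoids [Q n]. *)
exists y; split; last by case=> _ Qy; apply: Q1; rewrite -(mulVf y0); apply: QM.
by apply: IP; exists 0, 1; rewrite mulr1 add0r; split=> //; [apply: subring0 | case: sT0].
Qed.

Lemma valuative_dim_eqE R n : is_subring R -> valuative_dim_eq R n <->
  (@overring_chain K R n /\ ~ @overring_chain K R n.+1).
Proof.
have up m : overring_chain R m -> exists V, is_valuation_overring R V /\ has_prime_chain V m.
  move=> [T [[sT RT] /(valuation_overring_chain sT)[W [[[sW TW] vW] cW]]]].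
  by exists W; do !split=> //; auto.
move=> sR; split=> [[[V [[oV vV] cV]] nV]|[/up vn nvn]].
  by split; [exists V | case/up => W [vW cW]; apply: (nV W)].
by split=> // V [oV vV] cV; apply: nvn; exists V.
Qed.

End Enlarging.

(** * Morphisms out of a field of fractions *)

Section FractionMorphism.
Variables (A : idomainType) (F : fieldType) (f : {rmorphism A -> F}).
Hypothesis f_inj : forall a, f a = 0 -> a = 0.

Local Notation "x %:F" := (@FracField.tofrac _ x) (format "x %:F").

Lemma fraction_repr (x : {fraction A}) : x = (\n_(repr x))%:F / (\d_(repr x))%:F.
Proof.
have d0 : (\d_(repr x))%:F != 0 :> {fraction A} by rewrite tofrac_eq0 denom_ratioP.
apply: (mulIf d0); rewrite divfK // -{1}[x]reprK; move: (repr x) d0 => r _.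
unlock FracField.tofrac; rewrite -[LHS]FracField.pi_mul.
by apply/eqmodP; rewrite /= FracField.equivfE /FracField.mulf !numden_Ratio ?oner_neq0 ?mulr1 ?mul1r ?denom_ratioP // mulrC.
Qed.

Lemma fraction_ind (x : {fraction A}) : exists a b, b != 0 /\ x = a%:F / b%:F.
Proof. by exists (\n_(repr x)), (\d_(repr x)); split; [exact: denom_ratioP | exact: fraction_repr]. Qed.

Lemma fraction_lift : exists phi : {rmorphism {fraction A} -> F}, forall a, phi a%:F = f a.
Proof.
have f0 (a : A) : a != 0 -> f a != 0 by apply: contra => /eqP/f_inj ->.
pose g (x : {fraction A}) := f \n_(repr x) / f \d_(repr x).
have gE (a b : A) : b != 0 -> g (a%:F / b%:F) = f a / f b.
  move=> b0; rewrite /g; set x := a%:F / b%:F.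
  have d0 : \d_(repr x) != 0 := denom_ratioP _.
  have /eqP := fraction_repr x; rewrite {1}/x; move: (\n_(repr x)) (\d_(repr x)) d0 => n d d0.
  rewrite eqr_div ?tofrac_eq0 // -!tofracM tofrac_eq => /eqP e.
  by apply/eqP; rewrite eqr_div ?f0 // -!rmorphM -e.
have gF a : g a%:F = f a by rewrite -[a%:F]divr1 -tofrac1 gE ?oner_neq0 // rmorph1 divr1.
have gB : zmod_morphism g.
  move=> x y; have [a [b [b0 ->]]] := fraction_ind x; have [c [d [d0 ->]]] := fraction_ind y.
  have -> : a%:F / b%:F - c%:F / d%:F = (a * d - c * b)%:F / (b * d)%:F.
    by rewrite tofracB !tofracM -mulNr addf_div ?tofrac_eq0 // mulNr.
  by rewrite !gE ?mulf_neq0 // rmorphB !rmorphM; field; rewrite !f0.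
have gM : monoid_morphism g.
  split=> [|x y]; first by rewrite -tofrac1 gF rmorph1.
  have [a [b [b0 ->]]] := fraction_ind x; have [c [d [d0 ->]]] := fraction_ind y.
  have -> : a%:F / b%:F * (c%:F / d%:F) = (a * c)%:F / (b * d)%:F.
    by rewrite !tofracM mulf_div.
  by rewrite !gE ?mulf_neq0 // !rmorphM; field; rewrite !f0.
pose gZ := GRing.isZmodMorphism.Build _ _ g gB.
pose gMM := GRing.isMonoidMorphism.Build _ _ g gM.
pose phi : {rmorphism {fraction A} -> F} := HB.pack g gZ gMM.
by exists phi.
Qed.

End FractionMorphism.

(** * Rank of a valuation ring of an extension of transcendence degree one *)

Section RankInequality.
Variables (K L : fieldType) (phi : {rmorphism K -> L}).

(** A nonzero polynomial in two variables given as a list of monomials, distinct by injectivity of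
    [e], so that the terms of the relation can be compared in a valuation ring. *)
Definition alg_dependent (a b : L) := exists m (e : 'I_m -> nat * nat) (c : 'I_m -> K),
  [/\ injective e, exists i, c i != 0
    & \sum_i phi (c i) * (a ^+ (e i).1 * b ^+ (e i).2) = 0].

Variables (W : L -> Prop) (sW : is_subring W) (vW : is_valuation_ring W).

Lemma valuation_max_term m (t : 'I_m -> L) : (exists i, t i != 0) ->
  exists2 j, t j != 0 & forall i, W (t i / t j).
Proof.
move=> [i0 ti0]; case: (sW) => W1 _ WM.
suff [j [tj _ Wj]] : exists j, [/\ t j != 0, W (t i0 / t j) & forall i, i \in enum 'I_m -> W (t i / t j)].
  by exists j => // i; apply: Wj; rewrite mem_enum.
elim: (enum 'I_m) => [|k s [j [tj Wi0 Wj]]]; first by exists i0; rewrite divff.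
have [tk|tk] := eqVneq (t k) 0.
  exists j; split=> // i; rewrite inE => /predU1P[->|/Wj //].
  by rewrite tk mul0r; apply: subring0.
have /vW : t k / t j != 0 by rewrite mulf_neq0 ?invr_eq0.
case=> Wkj; first by exists j; split=> // i; rewrite inE => /predU1P[->|/Wj].
have tr i : W (t i / t j) -> W (t i / t k).
  move=> Wi; rewrite (_ : _ / _ = t i / t j * (t k / t j)^-1); first exact: WM.
  by field; rewrite tk tj.
exists k; split=> // [|i]; first exact: tr.
by rewrite inE => /predU1P[->|/Wj/tr //]; rewrite divff.
Qed.

(** Divide by a term of least valuation: if no other ratio were a unit of [W], then 1 would be minus
    a sum of nonunits. *)
Lemma valuation_sum0 m (t : 'I_m -> L) : (exists i, t i != 0) -> \sum_i t i = 0 ->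
  exists i j, [/\ i != j, t i != 0, t j != 0, W (t i / t j) & W (t i / t j)^-1].
Proof.
move=> /valuation_max_term[j tj Wj] st0.
have [iN N1 _] := nonunits_prime sW vW.
apply: contrapT => no; apply: N1.
have -> : 1 = - \sum_(i | i != j) t i / t j.
  rewrite -mulr_suml; apply: (mulIf tj); rewrite mul1r mulNr divfK //.
  by move/eqP: st0; rewrite (bigD1 j) //= addr_eq0 => /eqP.
apply: (idealN sW iN); apply: (ideal_sum _ iN) => i ij.
have [-> |ti] := eqVneq (t i) 0; first by left; rewrite mul0r.
by right=> Wji; apply: no; exists i, j.
Qed.

(* [Q]-units: the units of the localization of [W] at [Q]. *)
Definition prime_units (Q : L -> Prop) x := ~ Q x /\ ~ Q x^-1.

Section PrimeUnits.
Variables (Q : L -> Prop) (pQ : is_prime_ideal W Q).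

Lemma prime_units_neq0 x : prime_units Q x -> x != 0.
Proof. by move=> [nQ _]; apply/eqP => x0; apply: nQ; rewrite x0; case: pQ => -[]. Qed.

Lemma prime_unitsV x : prime_units Q x -> prime_units Q x^-1.
Proof. by case=> nQ nQV; split; rewrite ?invrK. Qed.

Lemma prime_unitsM x y : prime_units Q x -> prime_units Q y -> prime_units Q (x * y).
Proof.
have [[QW Q0 QD QM] Q1 Qp] := pQ.
suff mul a b : prime_units Q a -> prime_units Q b -> ~ Q (a * b).
  by move=> ux uy; split; [exact: mul | rewrite invfM; apply: mul; apply: prime_unitsV].
move=> ua ub Qab; have [a0 b0] := (prime_units_neq0 ua, prime_units_neq0 ub).
have [[Wb|Wb] [Wa|Wa]] := (vW b0, vW a0).
- by case: ua ub => na _ [nb _]; case: (Qp _ _ Wa Wb Qab).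
- by case: ub => nb _; apply: nb; rewrite -[b](mulKf a0); apply: QM.
- by case: ua => na _; apply: na; rewrite -[a](mulfK b0) mulrC; apply: QM.
- by case: ua => na _; apply: na; rewrite -[a](mulfK b0) mulrC; apply: QM.
Qed.

Lemma prime_unitsX x n : prime_units Q x -> prime_units Q (x ^+ n).
Proof.
have [_ Q1 _] := pQ; move=> ux; elim: n => [|n IHn]; last by rewrite exprS; apply: prime_unitsM.
by rewrite expr0; split; rewrite ?invr1.
Qed.

Lemma prime_units_sub x : W x -> W x^-1 -> x != 0 -> prime_units Q x.
Proof.
have [[_ _ _ QM] Q1 _] := pQ; move=> Wx WVx x0.
by split=> Qx; apply: Q1; [rewrite -(mulVf x0) | rewrite -(divff x0)]; apply: QM.
Qed.

Lemma prime_units_out x : W x -> ~ Q x -> prime_units Q x.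
Proof.
have [[_ Q0 _ QM] Q1 _] := pQ; move=> Wx nQx; split=> // QVx; apply: Q1.
have x0 : x != 0 by apply/eqP => x0; apply: nQx; rewrite x0.
by rewrite -(divff x0); apply: QM.
Qed.

Lemma prime_units_pow_eq x k l : Q x -> prime_units Q (x ^+ k / x ^+ l) -> k = l.
Proof.
have [[QW Q0 _ QM] Q1 _] := pQ; move=> Qx.
have [->|x0] := eqVneq x 0.
  case: k l => [|k] [|l] //; rewrite ?expr0 ?expr0n /= => /prime_units_neq0;
  by rewrite ?invr0 ?mulr0 ?mul0r eqxx.
have pos j : prime_units Q (x ^+ j) -> j = 0%N.
  case: j => // j [+ _]; case; rewrite exprSr; apply: QM => //.
  by apply: subringX => //; apply: QW.
move=> u; case: (leqP k l) => kl.
  have := prime_unitsV u; rewrite invf_div -expfB_cond ?(negPf x0) // => /pos; lia.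
by move: u; rewrite -expfB // => /pos; lia.
Qed.

End PrimeUnits.

Lemma prime_unitsS (Q Q' : L -> Prop) x :
  (forall x, Q x -> Q' x) -> prime_units Q' x -> prime_units Q x.
Proof. by move=> QQ' [n nV]; split=> [/QQ'|/QQ']. Qed.

(* A relation between [a] and [b] gives a ratio of two of its terms that is a
   unit of [W]; read modulo each of the four primes it forces equal exponents. *)
Lemma contractions_coincide_once (Q1 Q2 Q3 Q4 : L -> Prop) a b :
  is_prime_ideal W Q1 -> is_prime_ideal W Q2 -> is_prime_ideal W Q3 -> is_prime_ideal W Q4 ->
  (forall x, Q2 x -> Q3 x) -> (forall x, Q1 x -> Q2 x) ->
  (forall c : K, Q2 (phi c) -> Q1 (phi c)) -> (forall c : K, Q4 (phi c) -> Q3 (phi c)) ->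
  Q2 a -> ~ Q1 a -> Q4 b -> ~ Q3 b -> alg_dependent a b -> False.
Proof.
move=> p1 p2 p3 p4 S23 S12 C12 C34 Q2a nQ1a Q4b nQ3b [m [e [c [inj [i0 ci0] rel]]]].
have [Wa Wb] : W a /\ W b by split; [have [[+ _ _ _] _ _] := p2 | have [[+ _ _ _] _ _] := p4]; apply.
have neq0 (Q : L -> Prop) x : is_prime_ideal W Q -> ~ Q x -> x != 0.
  by move=> [[_ Q0 _ _] _ _] nQ; apply/eqP => x0; apply: nQ; rewrite x0.
have [a0 b0] := (neq0 _ _ p1 nQ1a, neq0 _ _ p3 nQ3b).
pose t i := phi (c i) * (a ^+ (e i).1 * b ^+ (e i).2).
have t0 i : c i != 0 -> t i != 0 by move=> ci; rewrite !mulf_neq0 ?fmorph_eq0 ?expf_neq0.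
have [|i [j [ij ti tj Wij WVij]]] := @valuation_sum0 m t _ rel; first by exists i0; apply: t0.
have [ci cj] : c i != 0 /\ c j != 0.
  by split; [move: ti | move: tj]; apply: contraNneq => c0; rewrite /t c0 rmorph0 mul0r.
have tij0 : t i / t j != 0 by rewrite mulf_neq0 ?invr_eq0.
set u := t i / t j in Wij WVij tij0.
pose r := phi (c i / c j); pose ra := a ^+ (e i).1 / a ^+ (e j).1; pose rb := b ^+ (e i).2 / b ^+ (e j).2.
have uE : u = r * ra * rb.
  by rewrite /u /t /r /ra /rb fmorph_div /=; field; rewrite !expf_neq0 ?fmorph_eq0.
have [r0 [ra0 rb0]] : r != 0 /\ ra != 0 /\ rb != 0.
  by rewrite /r /ra /rb fmorph_eq0 !mulf_neq0 ?invr_eq0 ?expf_neq0.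
have up Q x k l : is_prime_ideal W Q -> prime_units Q x -> prime_units Q (x ^+ k / x ^+ l).
  by move=> pQ ux; apply: (prime_unitsM pQ); [|apply: prime_unitsV]; apply: prime_unitsX.
have a1 := prime_units_out p1 Wa nQ1a; have b3 := prime_units_out p3 Wb nQ3b.
have b2 := prime_unitsS S23 b3; have b1 := prime_unitsS S12 b2.
have lift (Q Q' : L -> Prop) : (forall c : K, Q' (phi c) -> Q (phi c)) ->
    prime_units Q r -> prime_units Q' r.
  by move=> CQ [n1 n2]; split=> [/CQ //|]; rewrite /r -fmorphV => /CQ; rewrite fmorphV.
(* [b] is outside [Q3], hence a unit at [Q1] and [Q2], and [a] is a unit at [Q1]; so
   [r = u / (ra rb)] is a unit at [Q1]. As [r] comes from [K], where [Q1] and [Q2] agree, it is a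
   unit at [Q2]. Then so is [ra], although [a] is in [Q2]. *)
have e1 : (e i).1 = (e j).1.
  apply: (prime_units_pow_eq p2 Q2a); rewrite -/ra.
  have r2 : prime_units Q2 r.
    apply: lift C12 _; rewrite (_ : r = u * (ra * rb)^-1); last by rewrite uE -[r * ra * rb]mulrA (mulfK (mulf_neq0 ra0 rb0)).
    apply: (prime_unitsM p1); first exact: prime_units_sub.
    by apply: prime_unitsV; apply: (prime_unitsM p1); apply: up.
  rewrite (_ : ra = u * (r * rb)^-1); last by rewrite uE [r * ra]mulrC -[ra * r * rb]mulrA (mulfK (mulf_neq0 r0 rb0)).
  apply: (prime_unitsM p2); first exact: prime_units_sub.
  by apply: prime_unitsV; apply: (prime_unitsM p2) => //; apply: up.
have ra1 : ra = 1 by rewrite /ra e1 divff ?expf_neq0.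
(* The powers of [a] have cancelled, so the same transfer works from [Q3] to [Q4] even though
   nothing is known of [a] there. *)
have e2 : (e i).2 = (e j).2.
  apply: (prime_units_pow_eq p4 Q4b); rewrite -/rb.
  have r4 : prime_units Q4 r.
    apply: lift C34 _; rewrite (_ : r = u * rb^-1); last by rewrite uE ra1 mulr1 mulfK.
    apply: (prime_unitsM p3); first exact: prime_units_sub.
    by apply: prime_unitsV; apply: up.
  rewrite (_ : rb = u * r^-1); last by rewrite uE ra1 mulr1 mulrC mulKf.
  by apply: (prime_unitsM p4); [exact: prime_units_sub | exact: prime_unitsV].
by case/eqP: ij; apply: inj; case: (e i) (e j) e1 e2 => [? ?] [? ?] /= -> ->.
Qed.

Lemma valuation_contract_chain n : (forall a b, alg_dependent a b) ->
  has_prime_chain W n.+1 -> has_prime_chain (fun x => W (phi x)) n.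
Proof.
move=> dep [Q [Qp Qlt]].
have sV : is_subring (fun x => W (phi x)).
  case: sW => W1 WB WM; split; rewrite ?rmorph1 // => x y Vx Vy.
    by rewrite rmorphB; apply: WB.
  by rewrite rmorphM; apply: WM.
have QS i : (i < n.+1)%N -> forall x, Q i x -> Q i.+1 x by move/Qlt => [].
pose eqc i := forall c : K, Q i.+1 (phi c) -> Q i (phi c).
have once i j : (i < j)%N -> (j < n.+1)%N -> eqc i -> eqc j -> False.
  move=> ij jn ci cj; have iN : (i < n.+1)%N by lia.
  have [_ [a [Qa nQa]]] := Qlt i iN; have [_ [b [Qb nQb]]] := Qlt j jn.
  apply: (@contractions_coincide_once (Q i) (Q i.+1) (Q j) (Q j.+1) a b) => //; try by apply: Qp; lia.
  - by move=> x; apply: (prime_chain_mono QS); lia.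
  - exact: QS.
have [i0 i0P] : exists i0, forall i, (i < n.+1)%N -> eqc i -> i = i0.
  have [[i0 [i0n c0]]|no] := pselect (exists i0, (i0 < n.+1)%N /\ eqc i0).
    exists i0 => i iN ci; case: (ltngtP i i0) => // lt; first by case: (once i i0).
    by case: (once i0 i).
  (* When all contractions are distinct, 0 is a default and one prime is dropped all the same. *)
  by exists 0%N => i iN ci; case: no; exists i.
(* The enumeration omits [Q i0.+1], the upper of the two primes whose contractions may coincide. *)
pose s i := if (i <= i0)%N then i else i.+1.
have sn i : (i <= n)%N -> (s i <= n.+1)%N by rewrite /s; case: ifP; lia.
have sS i : (i < n)%N -> (s i < s i.+1 <= n.+1)%N by rewrite /s; do 2 case: ifP; lia.
apply: (@chain_contract K L phi _ W sV _ n (fun i => Q (s i))) => // i ltin.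
- by apply: Qp; apply: sn.
- by move=> x; apply: (prime_chain_mono QS); have := sS i ltin; lia.
(* Between two retained primes there is a step other than [i0], whose contraction is strict; for
   [i = i0] it is the step leaving the omitted prime. *)
have [k [kn ki sk ks]] : exists k, [/\ (k < n.+1)%N, k != i0, (s i <= k)%N & (k < s i.+1)%N].
  have := sS i ltin; rewrite /s; have [ei|] := eqVneq i i0.
    by exists i0.+1; move: ltin; rewrite ei; rewrite leqnn ltnn; split; lia.
  by case: ifP => ?; case: ifP => ? ? ?; [exists i|exists i|exists i.+1|exists i.+1]; split; lia.
apply: contrapT => no; case/eqP: ki; apply: i0P => // c Qc.
apply: contrapT => nQc; apply: no; exists c; split.
- by have [[+ _ _ _] _ _] := Qp _ kn; apply.
- by apply: (prime_chain_mono QS) Qc; have := sS i ltin; lia.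
- by move=> Qs; apply: nQc; apply: (prime_chain_mono QS) Qs; lia.
Qed.

End RankInequality.

Lemma overring_chain_contract (K L : fieldType) (phi : {rmorphism K -> L})
    (R : K -> Prop) (T : L -> Prop) n :
  (forall a b, alg_dependent phi a b) -> (forall x, R x -> T (phi x)) ->
  overring_chain T n.+1 -> overring_chain R n.
Proof.
move=> dep RT [S [[sS TS] cS]].
have [W [[[sW SW] vW] cW]] := valuation_overring_chain sS cS.
exists (fun x => W (phi x)); split; last exact: valuation_contract_chain cW.
split=> [|x /RT/TS/SW //]; case: sW => W1 WB WM; split; rewrite ?rmorph1 // => x y Vx Vy.
  by rewrite rmorphB; apply: WB.
by rewrite rmorphM; apply: WM.
Qed.

(** * Gauss extension and algebraic dependence *)

Section GaussExtension.
Variables (K L : fieldType) (phi : {rmorphism K -> L}) (ev : {rmorphism {poly K} -> L}).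
Hypothesis evC : forall c, ev c%:P = phi c.
Hypothesis ev_inj : forall p, ev p = 0 -> p = 0.
Implicit Types (R I P : K -> Prop) (p q : {poly K}).

Definition coefs_in (A : K -> Prop) p := forall i, A p`_i.

Lemma coefs_inC A c : A 0 -> coefs_in A c%:P <-> A c.
Proof.
move=> A0; split=> [/(_ 0%N)|Ac i]; first by rewrite coefC.
by rewrite coefC; case: eqP.
Qed.

Lemma coefs_inB R p q : is_subring R -> coefs_in R p -> coefs_in R q -> coefs_in R (p - q).
Proof. by case=> _ RB _ Rp Rq i; rewrite coefB; apply: RB. Qed.

Lemma coefs_in_idealM R I p q : is_ideal R I -> coefs_in R p -> coefs_in I q -> coefs_in I (p * q).
Proof.
move=> iI Rp Iq i; rewrite coefM; apply: (ideal_sum _ iI) => j _.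
by case: iI => _ _ _; apply.
Qed.

(* Gauss's lemma: [P[X]] is prime, by looking at the lowest coefficients
   of the two factors outside [P]. *)
Lemma coefs_in_prime R P p q : is_subring R -> is_prime_ideal R P ->
  coefs_in R p -> coefs_in R q -> coefs_in P (p * q) -> coefs_in P p \/ coefs_in P q.
Proof.
move=> sR [iP P1 Pp] Rp Rq Ppq.
have low r : ~ coefs_in P r -> exists i, ~ P r`_i /\ forall j, (j < i)%N -> P r`_j.
  move=> nPr; have [i0 ni0] : exists i, `[< ~ P r`_i >].
    by apply: contrapT => no; apply: nPr => i; apply: contrapT => nPi; apply: no; exists i; apply/asboolP.
  have ex : exists i, `[< ~ P r`_i >] by exists i0.
  case: (ex_minnP ex) => i /asboolP nPi min; exists i; split=> // j ji.
  by apply: contrapT => /asboolP/min; rewrite leqNgt ji.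
apply: contrapT => /not_orP[/low[i [ni lti]] /low[j [nj ltj]]].
suff : P (p`_i * q`_j) by case/Pp.
have iltS : (i < (i + j).+1)%N by lia.
have := Ppq (i + j)%N; rewrite coefM (bigD1 (Ordinal iltS)) //= addKn.
set s := \sum_(_ | _) _ => Ps; rewrite -(addrK s (_ * _)).
apply: (idealB sR iP) => //; apply: (ideal_sum _ iP) => k /eqP neki.
case: iP => _ _ _ PM; case: (ltngtP k i) => ki.
- by rewrite mulrC; apply: PM => //; apply: lti.
- by apply: PM => //; apply: ltj; have := ltn_ord k; lia.
- by case: neki; apply: val_inj.
Qed.

(** [Q i] is the extension of [P_ i [X]] to the localization, and contracts to [P_ i]. The clause on
    fractions serves to recognize [D[X]_N] inside [T]. *)
Lemma gauss_chain R (P_ : nat -> K -> Prop) n : is_subring R ->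
  (forall i, (i <= n)%N -> is_prime_ideal R (P_ i)) ->
  (forall i, (i < n)%N -> forall x, P_ i x -> P_ i.+1 x) ->
  exists T (Q : nat -> L -> Prop), [/\ is_subring T,
    forall p s, coefs_in R p -> coefs_in R s -> ~ coefs_in (P_ n) s -> T (ev p / ev s),
    forall i, (i <= n)%N -> is_prime_ideal T (Q i),
    forall i, (i < n)%N -> forall x, Q i x -> Q i.+1 x
    & forall i r, (i <= n)%N -> R r -> Q i (phi r) <-> P_ i r].
Proof.
move=> sR Pp PS; case: (sR) => R1 RB RM.
have evI : injective ev.
  by move=> p q e; apply/eqP; rewrite -subr_eq0; apply/eqP/ev_inj; rewrite rmorphB e subrr.
pose ex A (x : L) := exists2 p, coefs_in A p & x = ev p.
have exE A p : ex A (ev p) <-> coefs_in A p.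
  by split=> [[q Aq /evI ->]|Ap] //; exists p.
have R0 := subring0 sR.
have sB : is_subring (ex R).
  split; first by exists 1%:P; rewrite ?rmorph1 // coefs_inC.
  - by move=> _ _ [p Rp ->] [q Rq ->]; exists (p - q); rewrite ?rmorphB //; apply: coefs_inB.
  - move=> _ _ [p Rp ->] [q Rq ->]; exists (p * q); rewrite ?rmorphM //.
    exact: coefs_in_idealM (ideal_self sR) _ _.
have pB i : (i <= n)%N -> is_prime_ideal (ex R) (ex (P_ i)).
  move=> /Pp pP; case: (pP) => iP P1 _; case: (iP) => PR P0 PD PM; split.
  - split.
    + by move=> _ [p Ap ->]; exists p => // j; apply: PR.
    + by exists 0; rewrite ?rmorph0 // => j; rewrite coef0.
    + move=> _ _ [p Ap ->] [q Aq ->]; exists (p + q); rewrite ?rmorphD // => j.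
      by rewrite coefD; apply: PD.
    + move=> _ _ [p Ap ->] [q Aq ->]; exists (p * q); rewrite ?rmorphM //.
      exact: coefs_in_idealM iP _ _.
  - by rewrite -(rmorph1 ev) exE => /(_ 0%N); rewrite coef1.
  - by move=> _ _ [p Rp ->] [q Rq ->]; rewrite -rmorphM !exE; apply: (coefs_in_prime sR pP).
have mS := prime_compl_mult_set sB (pB n (leqnn n)).
set S := (fun s => _) in mS.
have exS i : (i < n)%N -> forall x, ex (P_ i) x -> ex (P_ i.+1) x.
  by move=> ltin x [p Pip ->]; exists p => // j; apply: PS.
have nS i s : (i <= n)%N -> S s -> ~ ex (P_ i) s.
  by move=> lein [_ ns] Ps; apply: ns; apply: (prime_chain_mono exS) Ps; rewrite lein leqnn.
exists (loc (ex R) S), (fun i => loc (ex (P_ i)) S); split.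
- exact: loc_subring.
- by move=> p s Rp Rs nPs; exists (ev p), (ev s); split=> //; [exists p|split; [exists s|rewrite exE]].
- by move=> i lein; apply: loc_prime => //; [apply: pB | move=> s; apply: nS].
- by move=> i ltin x [a [s [Pa Ss ->]]]; exists a, s; split=> //; apply: exS.
move=> i r lein Rr; have Pi0 : P_ i 0 by case: (Pp i lein) => -[].
rewrite (loc_contract (pB i lein) mS) -?evC; first by rewrite exE coefs_inC.
  by move=> s; apply: nS.
by apply/exE/coefs_inC.
Qed.

Hypothesis ev_frac : forall z, exists p q, q != 0 /\ z = ev p / ev q.

Lemma size_exp_bound p d n : (size p <= d.+1)%N -> (size (p ^+ n) <= (d * n).+1)%N.
Proof.
move=> pd; apply: leq_trans (size_exp_leq p n) _; rewrite ltnS leq_mul2r.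
by apply/orP; right; lia.
Qed.

(* The monomials of degree less than [N] in each of [a] and [b], multiplied by a
   common denominator, are [N^2] polynomials of degree at most [2 d N]. *)
Lemma polynomial_alg_dependent a b : alg_dependent phi a b.
Proof.
have [f1 [g1 [g10 ea]]] := ev_frac a; have [f2 [g2 [g20 eb]]] := ev_frac b.
pose f := f1 * g2; pose h := f2 * g1; pose g := g1 * g2.
have ev0 p : p != 0 -> ev p != 0 by apply: contra => /eqP/ev_inj ->.
have [evg1 evg2] := (ev0 _ g10, ev0 _ g20).
have g0 : g != 0 by rewrite mulf_neq0.
have eaf : ev f = a * ev g by rewrite ea /f /g !rmorphM /= mulrA divfK.
have ebh : ev h = b * ev g by rewrite eb /h /g !rmorphM /= [ev g1 * _]mulrC mulrA divfK.
clearbody f h g; move: (ev0 _ g0) => evg {f1 f2 g1 g2 ea eb g10 g20 evg1 evg2}.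
(* With this [N], the [N * N = 2 d N + 2 N] polynomials outnumber the [2 d N + 1] coefficients of a
   polynomial of degree at most [2 d N]. *)
pose d := (size f + size h + size g)%N; pose N := (2 * d + 2)%N.
pose e (i : 'I_(N * N)) := ((i %/ N)%N, (i %% N)%N).
(* Since [a = f / g] and [b = h / g], this is [a^k b^l g^(2 N)], with the pair [(k, l)] read from
   [i] in base [N]. *)
pose P (i : 'I_(N * N)) := f ^+ (e i).1 * h ^+ (e i).2 * g ^+ (2 * N - (e i).1 - (e i).2).
have N0 : (0 < N)%N by rewrite /N; lia.
have eN i : ((e i).1 < N)%N /\ ((e i).2 < N)%N by rewrite /e /= ltn_divLR // ltn_ord ltn_mod.
have sP i : (size (P i) <= (2 * d * N).+1)%N.
  have [e1 e2] := eN i; rewrite /P; move: (e i).1 (e i).2 e1 e2 => k l kN lN.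
  have sf : (size (f ^+ k) <= (d * k).+1)%N by apply: size_exp_bound; rewrite /d; lia.
  have sh : (size (h ^+ l) <= (d * l).+1)%N by apply: size_exp_bound; rewrite /d; lia.
  have sg : (size (g ^+ (2 * N - k - l)) <= (d * (2 * N - k - l)).+1)%N.
    by apply: size_exp_bound; rewrite /d; lia.
  have -> : (2 * d * N = d * k + d * l + d * (2 * N - k - l))%N.
    by rewrite -!mulnDr [(2 * d)%N]mulnC -mulnA; congr (_ * _)%N; lia.
  have m1 := size_polyMleq (f ^+ k * h ^+ l) (g ^+ (2 * N - k - l)).
  have m2 := size_polyMleq (f ^+ k) (h ^+ l).
  clearbody N d; lia.
pose M := \matrix_(i < N * N, j < (2 * d * N).+1) (P i)`_j.
have : kermx M != 0.
  rewrite kermx_eq0 -row_leq_rank -ltnNge; apply: leq_ltn_trans (rank_leq_col _) _.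
  have -> : (N * N = 2 * d * N + 2 * N)%N by rewrite -mulnDl.
  by lia.
case/rowV0Pn => v /sub_kermxP vM v0.
exists (N * N)%N, e, (v 0); split.
- move=> i j [e1 e2]; apply: val_inj => /=.
  by rewrite (divn_eq i N) (divn_eq j N) e1 e2.
- by case/rV0Pn: v0 => i vi; exists i.
have sum0 : \sum_i v 0 i *: P i = 0.
  apply/polyP => j; rewrite coef_sum coef0; case: (ltnP j (2 * d * N).+1) => jd.
    have /matrixP/(_ 0 (Ordinal jd)) := vM; rewrite !mxE => vM0; apply: etrans vM0.
    by apply: eq_bigr => i _; rewrite coefZ mxE.
  by apply: big1 => i _; rewrite coefZ (nth_default _ (leq_trans (sP i) jd)) mulr0.
have evgN : ev g ^+ (2 * N) != 0 by rewrite expf_neq0.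
apply: (mulIf evgN); rewrite mul0r mulr_suml -[RHS](rmorph0 ev) -sum0 rmorph_sum.
apply: eq_bigr => i _; rewrite -mul_polyC !rmorphM !rmorphXn /= evC eaf ebh !exprMn.
have := eN i; rewrite /= => -[e1 e2]; rewrite -!mulrA; congr (_ * (_ * _)).
rewrite [RHS]mulrCA; congr (_ * _); rewrite -!exprD; congr (_ ^+ _).
clearbody N; lia.
Qed.

End GaussExtension.

(** * The rings [D[X]], [D[X]_A], [D[X]_U] and [D[X]_N] *)

Lemma mulf_div_cancel (F : fieldType) (a b c : F) : c != 0 -> a * c / (b * c) = a / b.
Proof. by move=> c0; rewrite -mulf_div divff // mulr1. Qed.

Lemma expfV_mul (F : fieldType) (x : F) i k : x != 0 -> (i <= k)%N ->
  x^-1 ^+ (k - i) * x ^+ k = x ^+ i.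
Proof.
move=> x0 ik; have -> : x ^+ k = x ^+ (k - i) * x ^+ i by rewrite -exprD subnK.
by rewrite mulrA exprVn mulVf ?mul1r // expf_neq0.
Qed.

Lemma mulf_mulK (F : fieldType) (a b c : F) : b != 0 -> c * b * (a / b) = c * a.
Proof. by move=> b0; rewrite [a / b]mulrC mulrA mulfK. Qed.

Section PolynomialRing.
Variable D : idomainType.
Local Notation "x %:F" := (@FracField.tofrac _ x) (format "x %:F").
Local Notation X := ('X : {poly D})%:F.

Let const : {rmorphism D -> {fraction {poly D}}} :=
  (@FracField.tofrac {poly D} \o polyC)%FUN.

Lemma tofrac_eq0_imp (A : idomainType) (a : A) : a%:F = 0 -> a = 0.
Proof. by move/eqP; rewrite tofrac_eq0 => /eqP. Qed.

Lemma tofracX_neq0 : X != 0.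
Proof. by rewrite tofrac_eq0 polyX_eq0. Qed.

Lemma horner_const (p : {poly D}) : (map_poly const p).[X] = p%:F.
Proof.
rewrite -[p in RHS]coefK poly_def rmorph_sum /= (horner_coef_wide _ (size_poly _ _)).
by apply: eq_bigr => i _; rewrite coef_map /= -mul_polyC rmorphM rmorphXn.
Qed.

(** Identifies the fraction field of [D[X]] with [K(X)], where [K] is the fraction field of [D]. *)
Lemma gauss_maps : exists (phi : {rmorphism {fraction D} -> {fraction {poly D}}})
    (ev : {rmorphism {poly {fraction D}} -> {fraction {poly D}}}),
  [/\ forall d : D, phi d%:F = d%:P%:F,
      forall c, ev c%:P = phi c,
      forall q : {poly D}, ev (map_poly (@FracField.tofrac D) q) = q%:F,
      forall p, ev p = 0 -> p = 0
    & forall z, exists p q, q != 0 /\ z = ev p / ev q].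
Proof.
have const_inj d : const d = 0 -> d = 0.
  by move/tofrac_eq0_imp/eqP; rewrite polyC_eq0 => /eqP.
have [phi phiE] := @fraction_lift D _ const const_inj.
pose ev : {rmorphism {poly {fraction D}} -> {fraction {poly D}}} :=
  (horner_eval X \o map_poly phi)%FUN.
have evC c : ev c%:P = phi c by rewrite /ev /= /horner_eval map_polyC hornerC.
have evF (q : {poly D}) : ev (map_poly (@FracField.tofrac D) q) = q%:F.
  by rewrite /ev /= /horner_eval -map_poly_comp -(horner_const q) (eq_map_poly (g := const)).
exists phi, ev; split=> //.
  move=> p evp0.
  (* Clearing the denominators of the coefficients reduces injectivity of [ev] to that of the
     embedding of [D[X]]. *)
  have [d [q [d0 eq]]] : exists (d : D) (q : {poly D}), d != 0 /\ d%:F%:P * p = map_poly (@FracField.tofrac D) q.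
    elim/poly_ind: p {evp0} => [|p c [d [q [d0 e]]]].
      by exists 1, 0; rewrite oner_neq0 mulr0 rmorph0.
    have [a [b [b0 ->]]] := fraction_ind c.
    exists (d * b), (b%:P * q * 'X + (d * a)%:P); split; first exact: mulf_neq0.
    rewrite rmorphD !rmorphM /= -e !map_polyC map_polyX /= mulrDr.
    congr (_ + _); first by move: d%:F%:P b%:F%:P => u v; rewrite !mulrA [u * v]mulrC.
    by rewrite -!polyCM; congr (_%:P); apply: mulf_mulK; rewrite tofrac_eq0.
  have /tofrac_eq0_imp q0 : q%:F = 0 by rewrite -evF -eq rmorphM evp0 mulr0.
  move/eqP: eq; rewrite q0 rmorph0 mulf_eq0 polyC_eq0 tofrac_eq0 (negPf d0).
  by move/eqP.
move=> z; have [p [q [q0 ->]]] := fraction_ind z.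
exists (map_poly (@FracField.tofrac D) p), (map_poly (@FracField.tofrac D) q); rewrite !evF.
split=> //; apply: contraNneq q0 => mq0.
by apply/eqP/tofrac_eq0_imp; rewrite -evF mq0 rmorph0.
Qed.

(** This is [X^k p(1/X)] when [p] has degree at most [k]; [k] is left free so that a numerator and a
    denominator can be reversed with one exponent. *)
Definition reverse_poly (k : nat) (p : {poly D}) := \poly_(i < k.+1) p`_(k - i).

Lemma flip_map : exists sigma : {rmorphism {fraction {poly D}} -> {fraction {poly D}}},
  [/\ forall z, sigma (sigma z) = z, sigma X = X^-1
    & forall (p : {poly D}) k, (size p <= k.+1)%N -> sigma p%:F * X ^+ k = (reverse_poly k p)%:F].
Proof.
pose fl : {rmorphism {poly D} -> {fraction {poly D}}} :=
  (horner_eval X^-1 \o map_poly const)%FUN.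
have flE (p : {poly D}) n : (size p <= n)%N -> fl p = \sum_(i < n) const p`_i * X^-1 ^+ i.
  move=> pn; rewrite /fl /= /horner_eval (@horner_coef_wide _ n).
    by apply: eq_bigr => i _; rewrite coef_map.
  by apply: leq_trans (size_poly _ _) pn.
have X0 := tofracX_neq0.
have rev (p : {poly D}) k : (size p <= k.+1)%N -> fl p * X ^+ k = (reverse_poly k p)%:F.
  move=> pk; rewrite (flE _ _ pk) mulr_suml /reverse_poly poly_def rmorph_sum.
  rewrite (reindex_inj rev_ord_inj); apply: eq_bigr => i _ /=.
  rewrite subSS -mul_polyC rmorphM rmorphXn /= -mulrA; congr (_ * _).
  have ik : (i <= k)%N by rewrite -ltnS.
  exact: expfV_mul.
have fl_inj (p : {poly D}) : fl p = 0 -> p = 0.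
  move=> p0; have := rev p (size p) (leqnSn _); rewrite p0 mul0r.
  move/esym/tofrac_eq0_imp => r0; apply/polyP => i; rewrite coef0.
  case: (ltnP i (size p)) => ip; last by rewrite nth_default.
  have := congr1 (fun q : {poly D} => q`_(size p - i)) r0; rewrite coef_poly coef0 ltnS leq_subr subKn //.
  exact: ltnW.
have [sigma sE] := @fraction_lift {poly D} _ fl fl_inj.
have sX : sigma X = X^-1 by rewrite sE /fl /= /horner_eval map_polyX hornerX.
have ss (p : {poly D}) : sigma (sigma p%:F) = p%:F.
  rewrite sE (flE _ _ (leqnn _)) rmorph_sum -(horner_const p) (@horner_coef_wide _ (size p)) ?size_poly //.
  apply: eq_bigr => i _; rewrite rmorphM rmorphXn fmorphV sX invrK coef_map; congr (_ * _).
  by rewrite sE /fl /= /horner_eval map_polyC hornerC.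
exists sigma; split=> //; last by move=> p k; rewrite sE; apply: rev.
by move=> z; have [p [q [q0 ->]]] := fraction_ind z; rewrite !fmorph_div !ss.
Qed.

Lemma dom_D_subring : is_subring (dom_D D).
Proof.
split; first by exists 1; rewrite tofrac1.
- by move=> _ _ [a ->] [b ->]; exists (a - b); rewrite tofracB.
- by move=> _ _ [a ->] [b ->]; exists (a * b); rewrite tofracM.
Qed.

Lemma dom_DX_subring : is_subring (dom_DX D).
Proof.
split; first by exists 1; rewrite tofrac1.
- by move=> _ _ [a ->] [b ->]; exists (a - b); rewrite tofracB.
- by move=> _ _ [a ->] [b ->]; exists (a * b); rewrite tofracM.
Qed.

Lemma dom_DX_loc_subring (S : {poly D} -> Prop) : (forall s, S s -> s != 0) -> S 1 ->
  (forall s t, S s -> S t -> S (s * t)) -> is_subring (dom_DX_loc S).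
Proof.
move=> S0 S1 SM.
have -> : dom_DX_loc S = loc (dom_DX D) (fun x => exists2 s, S s & x = s%:F).
  apply: funext => x; rewrite propeqE; split.
    by case=> p [s [Ss ->]]; exists p%:F, s%:F; split=> //; [exists p | exists s].
  by case=> _ [_ [[p ->] [s Ss ->] ->]]; exists p, s.
apply: loc_subring; first exact: dom_DX_subring.
split; first by move=> _ [s Ss ->]; rewrite tofrac_eq0 S0 //; split=> //; exists s.
  by exists 1; rewrite ?tofrac1.
by move=> _ _ [s Ss ->] [t St ->]; exists (s * t); rewrite ?tofracM //; apply: SM.
Qed.

Lemma dom_DX_loc_sub (S : {poly D} -> Prop) x : S 1 -> dom_DX D x -> dom_DX_loc S x.
Proof. by move=> S1 [p ->]; exists p, 1; rewrite tofrac1 divr1. Qed.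

Lemma dom_DX_locS (S S' : {poly D} -> Prop) x :
  (forall s, S s -> S' s) -> dom_DX_loc S x -> dom_DX_loc S' x.
Proof. by move=> SS' [p [s [Ss ->]]]; exists p, s; split=> //; apply: SS'. Qed.

(** For [R] between [D[X]] and its localization no primes merge: a fraction witnessing strictness
    can be replaced by its numerator. *)
Lemma loc_chain_contract (S : {poly D} -> Prop) R n :
  is_subring R -> (forall x, dom_DX D x -> R x) -> (forall x, R x -> dom_DX_loc S x) ->
  (forall s, S s -> s != 0) -> S 1 ->
  has_prime_chain (dom_DX_loc S) n -> has_prime_chain R n.
Proof.
move=> sR DR RS S0 S1 [P [Pp Plt]].
apply: (@chain_contract _ _ idfun R _ sR RS n P) => // [i /Plt[] //|i ltin].
have [_ [x [Px nPx]]] := Plt i ltin.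
have [[PR _ _ _] _ _] := Pp _ ltin; have [[_ _ _ PM] _ _] := Pp _ ltin.
have [[_ _ _ PM'] _ _] := Pp _ (ltnW ltin).
have [p [s [Ss ex]]] := PR _ Px; have s0 : s%:F != 0 by rewrite tofrac_eq0 S0.
have ep : p%:F = s%:F * x by rewrite ex mulrC divfK.
exists p%:F; split=> /=; first by apply: DR; exists p.
  by rewrite ep; apply: PM => //; apply: dom_DX_loc_sub => //; exists s.
move=> Pp'; apply: nPx; rewrite ex mulrC; apply: PM' => //.
by exists 1, s; rewrite tofrac1 mul1r.
Qed.

Lemma polysA_subring : is_subring (dom_DX_loc (polysA D)).
Proof.
apply: dom_DX_loc_subring => [s||s t]; rewrite /polysA; first last.
- by rewrite hornerM => -> ->; rewrite mulr1.
- by rewrite hornerC.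
- by apply: contra_eq_neq => ->; rewrite horner0 eq_sym oner_neq0.
Qed.

Lemma polysU_subring : is_subring (dom_DX_loc (polysU D)).
Proof.
apply: dom_DX_loc_subring => [s||s t]; rewrite /polysU; first exact: monic_neq0.
  exact: monic1.
by move=> ms mt; rewrite monicMl.
Qed.

(** A proper content ideal lies in a prime. In this form, closure of [N] under products becomes
    Gauss's lemma. *)
Lemma polysNP (f : {poly D}) : polysN D f <->
  forall P, is_prime_ideal (dom_D D) P -> ~ coefs_in P (map_poly (@FracField.tofrac D) f).
Proof.
split=> [Nf P [[_ P0 PD PM] P1 _] Pf|noP d].
  have [a e1] := Nf 1; apply: P1; rewrite -tofrac1 e1 rmorph_sum.
  apply: big_ind => // i _; rewrite rmorphM; apply: PM; first by exists (a i).
  by have := Pf i; rewrite coef_map.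
have cM c e : content_ideal f e -> content_ideal f (c * e).
  by case=> a ->; exists (fun i => c * a i); rewrite mulr_sumr; apply: eq_bigr => i _; rewrite mulrA.
apply: contrapT => nd; pose I x := exists2 c, content_ideal f c & x = c%:F.
have iI : is_ideal (dom_D D) I.
  split.
  - by move=> _ [c _ ->]; exists c.
  - exists 0; rewrite ?tofrac0 //; exists (fun=> 0).
    by rewrite big1 // => i _; rewrite mul0r.
  - move=> _ _ [c [a ->] ->] [e [b ->] ->]; exists (\sum_(i < size f) (a i + b i) * f`_i).
      by exists (fun i => a i + b i).
    by rewrite -tofracD -big_split; congr (_%:F); apply: eq_bigr => i _; rewrite mulrDl.
  - by move=> _ _ [r ->] [c cc ->]; exists (r * c); rewrite ?tofracM //; apply: cM.
have nI1 : ~ I 1.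
  case=> c cc e1; apply: nd; rewrite -[d]mulr1; apply: cM; rewrite (_ : 1 = c) //.
  by apply/eqP; rewrite -tofrac_eq tofrac1 e1.
have [P [pP IP]] := prime_above dom_D_subring iI nI1.
apply: (noP P pP) => i; apply: IP; rewrite coef_map; exists f`_i => //.
case: (ltnP i (size f)) => [lti|gei].
  exists (fun j => (j == i)%:R); rewrite (bigD1 (Ordinal lti)) //= eqxx mul1r big1 ?addr0 // => j /eqP ne.
  by case: eqP => [e|]; rewrite ?mul0r //; case: ne; apply: val_inj.
by exists (fun=> 0); rewrite nth_default // big1 // => j _; rewrite mul0r.
Qed.

Lemma polysU_N (f : {poly D}) : polysU D f -> polysN D f.
Proof.
move=> Uf; apply/polysNP => P [_ P1 _] /(_ (size f).-1); rewrite coef_map -lead_coefE.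
by rewrite (monicP Uf) /= tofrac1.
Qed.

Lemma polysN1 : polysN D 1.
Proof. by apply: polysU_N; apply: monic1. Qed.

Lemma polysN_neq0 (f : {poly D}) : polysN D f -> f != 0.
Proof.
move=> Nf; apply/eqP => f0; have [a] := Nf 1; rewrite f0 size_poly0 big_ord0 => /eqP.
by rewrite oner_eq0.
Qed.

Lemma polysN_subring : is_subring (dom_DX_loc (polysN D)).
Proof.
apply: dom_DX_loc_subring => [|| s t /polysNP Ns /polysNP Nt]; [exact: polysN_neq0 | exact: polysN1|].
apply/polysNP => P pP; rewrite rmorphM.
have inD (f : {poly D}) : coefs_in (dom_D D) (map_poly (@FracField.tofrac D) f).
  by move=> i; rewrite coef_map; exists f`_i.
by case/(coefs_in_prime dom_D_subring pP (inD _) (inD _)); [apply: Ns | apply: Nt].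
Qed.

Lemma overring_chain_gauss (R : {fraction D} -> Prop) (P : nat -> {fraction D} -> Prop) n :
  is_overring (dom_D D) R ->
  (forall i, (i <= n)%N -> is_prime_ideal R (P i)) ->
  (forall i, (i < n)%N -> (forall x, P i x -> P i.+1 x) /\ exists x, P i.+1 x /\ ~ P i x) ->
  exists (phi : {rmorphism {fraction D} -> {fraction {poly D}}}) T Q,
  [/\ is_overring (dom_DX_loc (polysN D)) T, forall d : D, phi d%:F = d%:P%:F,
    forall i, (i <= n)%N -> is_prime_ideal T (Q i),
    forall i, (i < n)%N -> forall x, Q i x -> Q i.+1 x
    & forall i, (i < n)%N -> forall x, P i.+1 x -> ~ P i x -> Q i.+1 (phi x) /\ ~ Q i (phi x)].
Proof.
move=> [sR DR] Pp Plt; have [phi [ev [phiE evC evF ev_inj ev_frac]]] := gauss_maps.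
have [|T [Q [sT fT Qp QS QP]]] := gauss_chain evC ev_inj sR Pp; first by move=> i /Plt[].
exists phi, T, Q; split=> // [|i ltin x Px nPx].
  split=> // _ [p [s [Ns ->]]]; rewrite -!evF; apply: fT => [i|i|Pns].
  - by rewrite coef_map; apply: DR; exists p`_i.
  - by rewrite coef_map; apply: DR; exists s`_i.
  (* A denominator from [N] has unit content, so it avoids the extension of the contraction of [P n]
     to [D], and hence [P n [X]]. *)
  have pn := @prime_contract _ _ idfun _ _ dom_D_subring DR _ (Pp n (leqnn n)).
  move/polysNP: Ns => /(_ _ pn); apply=> i; split; last exact: Pns.
  by rewrite coef_map; exists s`_i.
have Rx : R x by have [[+ _ _ _] _ _] := Pp _ ltin; apply.
by split; [apply/QP | move/QP => /(_ (ltnW ltin) Rx)].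
Qed.

Lemma overring_chain_DX_N n :
  overring_chain (dom_D D) n -> overring_chain (dom_DX_loc (polysN D)) n.
Proof.
move=> [R [oR [P [Pp Plt]]]].
have [phi [T [Q [oT _ Qp QS Qlt]]]] := overring_chain_gauss oR Pp Plt.
exists T; split=> //; exists Q; split=> // i ltin; split; first exact: QS.
have [_ [x [Px nPx]]] := Plt i ltin.
by exists (phi x); apply: Qlt.
Qed.

(** For the overring [D] itself the witnesses of strictness are constants, which lie in [D[X]_N], so
    the chain of [T] contracts. *)
Lemma prime_chain_DX_N n :
  has_prime_chain (dom_D D) n -> has_prime_chain (dom_DX_loc (polysN D)) n.
Proof.
move=> [P [Pp Plt]].
have [|phi [T [Q [[sT NT] phiE Qp QS Qlt]]]] := @overring_chain_gauss (dom_D D) P n _ Pp Plt.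
  by split=> //; apply: dom_D_subring.
apply: (@chain_contract _ _ idfun _ _ polysN_subring NT n Q) => // i ltin.
have [_ [x [Px nPx]]] := Plt i ltin; have [Qx nQx] := Qlt i ltin x Px nPx.
exists (phi x); split=> //; have [[+ _ _ _] _ _] := Pp _ ltin => /(_ _ Px) [d ->].
by rewrite phiE; apply: dom_DX_loc_sub; [apply: polysN1 | exists d%:P].
Qed.

Lemma prime_chain_N_U n :
  has_prime_chain (dom_DX_loc (polysN D)) n -> has_prime_chain (dom_DX_loc (polysU D)) n.
Proof.
apply: loc_chain_contract; [exact: polysU_subring | | | exact: polysN_neq0 | exact: polysN1].
  by move=> x; apply: dom_DX_loc_sub; apply: monic1.
by move=> x; apply: dom_DX_locS => s; apply: polysU_N.
Qed.

Lemma prime_chain_A n :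
  has_prime_chain (dom_DX_loc (polysA D)) n -> has_prime_chain (dom_DX D) n.
Proof.
apply: loc_chain_contract; rewrite /polysA ?hornerC //; first exact: dom_DX_subring.
  by move=> x; apply: dom_DX_loc_sub; rewrite /polysA hornerC.
by move=> s; apply: contra_eq_neq => ->; rewrite horner0 eq_sym oner_neq0.
Qed.

(** * Transfer between [D[X]_U] and [D[X]_A] by the involution [X |-> 1/X] *)

Section Flip.
Variable sigma : {rmorphism {fraction {poly D}} -> {fraction {poly D}}}.
Hypothesis sigmaK : forall z, sigma (sigma z) = z.
Hypothesis sigmaX : sigma X = X^-1.
Hypothesis sigma_rev : forall (p : {poly D}) k, (size p <= k.+1)%N ->
  sigma p%:F * X ^+ k = (reverse_poly k p)%:F.

(** Reversal turns the constant term 1 of the denominator into the leading coefficient; [k] bounds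
    both degrees, so the factor [X^k] cancels. *)
Lemma flip_A_U x : dom_DX_loc (polysA D) x -> dom_DX_loc (polysU D) (sigma x).
Proof.
move=> [f [g [g1 ->]]]; pose k := (size f + size g)%N.
exists (reverse_poly k f), (reverse_poly k g); split.
  rewrite /polysU monicE /reverse_poly lead_coef_poly ?subnn -?horner_coef0 ?g1 //.
  exact: oner_neq0.
rewrite -!sigma_rev; try by rewrite /k; lia.
by rewrite mulf_div_cancel ?expf_neq0 ?tofracX_neq0 // fmorph_div.
Qed.

(** Reversing a monic denominator gives constant term 1, but the numerator leaves a negative power
    of [X], hence the factor [X ^+ k]. *)
Lemma flip_U_A x : dom_DX_loc (polysU D) x ->
  exists k, dom_DX_loc (polysA D) (sigma x * X ^+ k).
Proof.
move=> [p [s [Us ->]]]; pose m := (size s).-1; exists (size p).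
have sm : (size s <= m.+1)%N by rewrite /m; lia.
exists (reverse_poly (size p) p * 'X^m), (reverse_poly m s); split.
  rewrite /polysA horner_coef0 coef_poly subn0 -lead_coefE; exact/eqP.
rewrite tofracM tofracXn -(sigma_rev (leqnSn _)) -(sigma_rev sm).
by rewrite mulf_div_cancel ?expf_neq0 ?tofracX_neq0 // fmorph_div mulrAC.
Qed.

(** [1 - X f/g = (g - X f)/g], and [g - X f] again has constant term 1. *)
Lemma polysA_units b : dom_DX_loc (polysA D) b ->
  1 - X * b != 0 /\ dom_DX_loc (polysA D) (1 - X * b)^-1.
Proof.
move=> [f [g [g1 ->]]].
have nz (h : {poly D}) : polysA D h -> h%:F != 0.
  rewrite /polysA tofrac_eq0; apply: contra_eq_neq => ->.
  by rewrite horner0 eq_sym oner_neq0.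
have h1 : polysA D (g - 'X * f) by rewrite /polysA hornerD hornerN hornerM hornerX g1 mul0r subr0.
have -> : 1 - X * (f%:F / g%:F) = (g - 'X * f)%:F / g%:F.
  by rewrite tofracB tofracM mulrBl divff ?nz // mulrA.
split; first by rewrite mulf_neq0 ?invr_eq0 ?nz.
by exists g, (g - 'X * f); rewrite invf_div.
Qed.

(** [enlarge_chain] with [y = X] and the chain pulled back along [sigma]. It serves for [T0 =
    D[X]_A] and for the enlargement of [D[X]_A] by the pullback of [Q n]. *)
Lemma enlarge_flip T T0 n (Q : nat -> {fraction {poly D}} -> Prop) :
  is_overring (dom_DX_loc (polysU D)) T ->
  is_overring (dom_DX_loc (polysA D)) T0 -> (forall x, T0 x -> T (sigma x)) ->
  (forall i, (i <= n)%N -> is_prime_ideal T (Q i)) ->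
  (forall i, (i < n)%N -> forall x, Q i x -> Q i.+1 x) ->
  (forall i, (i < n)%N -> exists x, [/\ T0 x, Q i.+1 (sigma x) & ~ Q i (sigma x)]) ->
  (forall x, T0 x -> exists2 b, dom_DX_loc (polysA D) b & Q n (sigma (x - b))) ->
  has_prime_chain T0 n.+1.
Proof.
move=> [sT UT] [sT0 AT0] T0T Qp QS Qlt T0b.
have XDX : dom_DX D X by exists 'X.
have A1 : polysA D 1 by rewrite /polysA hornerC.
have sT1 : is_subring (fun x => T (sigma x)).
  case: sT => W1 WB WM; split; rewrite ?rmorph1 // => x y Vx Vy.
    by rewrite rmorphB; apply: WB.
  by rewrite rmorphM; apply: WM.
apply: (@enlarge_chain _ _ T0 X n (fun i x => T (sigma x) /\ Q i (sigma x)) sT1) => //.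
- by apply: AT0; apply: dom_DX_loc_sub.
- exact: tofracX_neq0.
- by rewrite fmorphV sigmaX invrK; apply: UT; apply: dom_DX_loc_sub => //; apply: monic1.
- by move=> i lein; apply: prime_contract (Qp i lein).
- by move=> i ltin x [Tx Qx]; split=> //; apply: QS.
- move=> i ltin; have [x [T0x Qx nQx]] := Qlt i ltin; exists x; split=> //; last by case.
  by split=> //; apply: T0T.
- move=> x T0x; have [b Ab Qb] := T0b x T0x; have [u0 Au] := polysA_units Ab.
  exists b; split=> //; last by apply: UT; apply: flip_A_U.
  by split=> //; have [[+ _ _ _] _ _] := Qp n (leqnn n); apply.
Qed.

End Flip.

Lemma prime_chain_U_A n :
  has_prime_chain (dom_DX_loc (polysU D)) n -> has_prime_chain (dom_DX_loc (polysA D)) n.+1.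
Proof.
move=> [Q [Qp Qlt]]; have [sigma [sigmaK sigmaX sigma_rev]] := flip_map.
have U1 : polysU D 1 by apply: monic1.
have UX : dom_DX_loc (polysU D) X by apply: dom_DX_loc_sub => //; exists 'X.
have UXV : dom_DX_loc (polysU D) X^-1.
  by exists 1, 'X; rewrite tofrac1 mul1r; split=> //; apply: monicX.
apply: (enlarge_flip sigmaX sigma_rev _ _ (flip_A_U sigma_rev) Qp) => [|| i /Qlt[] //|i ltin|x Ax].
- by split=> //; apply: polysU_subring.
- by split=> //; apply: polysA_subring.
- have [_ [x [Qx nQx]]] := Qlt i ltin; have [[QU _ _ QM] _ _] := Qp _ ltin.
  have [[_ _ _ QM'] _ _] := Qp _ (ltnW ltin).
  have [k Ak] := flip_U_A sigma_rev (QU _ Qx).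
  have X0 : X ^+ k != 0 by rewrite expf_neq0 // tofracX_neq0.
  (* [X] is a unit of [D[X]_U], so clearing the power of [X] does not change membership in the
     primes. *)
  exists (sigma x * X ^+ k); rewrite rmorphM rmorphXn /= sigmaK sigmaX; split=> //.
    by rewrite mulrC; apply: QM => //; apply: subringX => //; apply: polysU_subring.
  move=> Qxk; apply: nQx; rewrite (_ : x = X ^+ k * (x * X^-1 ^+ k)).
    by apply: QM' => //; apply: subringX => //; apply: polysU_subring.
  by rewrite exprVn mulrC divfK.
- by exists x => //; rewrite subrr rmorph0; case: (Qp n (leqnn n)) => -[].
Qed.

Lemma overring_chain_U_A n : overring_chain (dom_DX_loc (polysU D)) n ->
  overring_chain (dom_DX_loc (polysA D)) n.+1.
Proof.
move=> [T [[sT UT] [Q [Qp Qlt]]]]; have [sigma [sigmaK sigmaX sigma_rev]] := flip_map.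
have [[QT Q0 QD QM] _ _] := Qp n (leqnn n); case: (sT) => T1 TB TM.
have QB := idealB sT (And4 QT Q0 QD QM).
have AU := flip_A_U sigma_rev.
pose A := dom_DX_loc (polysA D).
(* Contraction to [D[X]_A] could merge primes of [T]. Adding the pullback of [Q n] keeps them apart,
   and every element is still congruent to one of [D[X]_A], where [1 - X b] is a unit. *)
pose T0 x := exists2 b, A b & Q n (sigma (x - b)).
have T0T x : T0 x -> T (sigma x).
  by case=> b Ab Qb; rewrite -(subrK b x) rmorphD; apply: subringD => //; auto.
have [A1 AB AM] := polysA_subring.
have AT0 x : A x -> T0 x by move=> Ax; exists x; rewrite // subrr rmorph0.
have sT0 : is_subring T0.
  split; first exact: AT0.
    move=> x y [b Ab Qb] [c Ac Qc]; exists (b - c); first exact: AB.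
    have -> : x - y - (b - c) = (x - b) - (y - c) by rewrite !opprD addrACA.
    by rewrite rmorphB; apply: QB.
  move=> x y T0x [c Ac Qc]; case: (T0x) => b Ab Qb; exists (b * c); first exact: AM.
  have -> : x * y - b * c = x * (y - c) + c * (x - b).
    by rewrite !mulrBr addrA [x * c]mulrC subrK [c * b]mulrC.
  by rewrite rmorphD !rmorphM; apply: QD; apply: QM => //; auto.
exists T0; split=> //.
apply: (enlarge_flip sigmaX sigma_rev _ _ T0T Qp) => // [i /Qlt[] //|i ltin].
have [_ [x [Qx nQx]]] := Qlt i ltin.
(* The witness lies in [Q i.+1], hence in [Q n], so its image is in [T0] with [b = 0]. *)
exists (sigma x); rewrite sigmaK; split=> //.
exists 0; first exact: subring0 polysA_subring.
rewrite subr0 sigmaK; apply: (prime_chain_mono _ _ Qx) => [j /Qlt[] //|].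
by rewrite ltin leqnn.
Qed.

Lemma overring_chain_DX n : overring_chain (dom_DX D) n.+1 -> overring_chain (dom_D D) n.
Proof.
have [phi [ev [phiE evC _ ev_inj ev_frac]]] := gauss_maps.
apply: (overring_chain_contract (phi := phi)).
  exact: polynomial_alg_dependent evC ev_inj ev_frac.
by move=> _ [d ->]; rewrite phiE; exists d%:P.
Qed.

End PolynomialRing.

(** * Jaffard domains and the four equivalences *)

Lemma jaffardE (K : fieldType) (R : K -> Prop) : is_subring R ->
  jaffard R <-> exists n, has_prime_chain R n /\ ~ overring_chain R n.+1.
Proof.
(* [dim <= v] always holds, so a lower bound for the dimension that meets an upper bound for [v]
   determines both. *)
move=> sR; split=> [[n [/(valuative_dim_eqE _ sR)[_ nv] [c _]]]|[n [c nv]]]; first by exists n.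
exists n; split; first by apply/valuative_dim_eqE => //; split=> //; apply: overring_chain_self.
by split=> // /(overring_chain_self sR).
Qed.

Theorem mainTheorem8 (D : idomainType) :
  [/\ jaffard (dom_D D) <->
        (jaffard (dom_DX D) /\ dim_eq_succ (dom_DX D) (dom_D D)),
      jaffard (dom_D D) <->
        (jaffard (dom_DX_loc (polysA D)) /\ dim_eq_succ (dom_DX D) (dom_D D)),
      jaffard (dom_D D) <->
        (jaffard (dom_DX_loc (polysU D)) /\ dim_eq_succ (dom_DX D) (dom_D D))
    & jaffard (dom_D D) <->
        (jaffard (dom_DX_loc (polysN D)) /\ dim_eq_succ (dom_DX D) (dom_D D))].
Proof.
have sD := dom_D_subring D; have sX := dom_DX_subring D; have sA := polysA_subring D.
have sU := polysU_subring D; have sN := polysN_subring D.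
have vNU n : overring_chain (dom_DX_loc (polysN D)) n -> overring_chain (dom_DX_loc (polysU D)) n.
  by apply: overring_chain_sub => x; apply: dom_DX_locS => s; apply: polysU_N.
have vAX n : overring_chain (dom_DX_loc (polysA D)) n -> overring_chain (dom_DX D) n.
  by apply: overring_chain_sub => x; apply: dom_DX_loc_sub; rewrite /polysA hornerC.
have vDN := @overring_chain_DX_N D; have vUA := @overring_chain_U_A D.
have vXD := @overring_chain_DX D.
have cDN := @prime_chain_DX_N D; have cNU := @prime_chain_N_U D.
have cUA := @prime_chain_U_A D; have cAX := @prime_chain_A D.
have c0 : has_prime_chain (dom_D D) 0.
  exists (fun _ x => x = 0); split=> // i _; split.
  - split=> // [x ->|x y -> ->|r x _ ->]; rewrite ?addr0 ?mulr0 //; exact: subring0.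
  - by move/eqP; rewrite oner_eq0.
  - by move=> a b _ _ /eqP; rewrite mulf_eq0 => /orP[]/eqP; [left | right].
have dim : jaffard (dom_D D) -> dim_eq_succ (dom_DX D) (dom_D D).
  move=> /(jaffardE sD)[n [c nv]] m; split; last by move/cDN/cNU/cUA/cAX.
  (* A chain of length [m + 1] in [D[X]] gives [v(D) >= m], hence [m <= n], and the chain of [D] of
     length [n] can be shortened. *)
  move/(overring_chain_self sX)/vXD => vm; apply: prime_chain_leq c.
  by rewrite leqNgt; apply/negP => nm; apply: nv; apply: overring_chain_leq vm.
(* The four equivalences are instances of one, [k] being the excess of the dimension of [R] over
   that of [D]: 1 for [D[X]] and [D[X]_A], 0 for the other two. *)
have main (L : fieldType) (R : L -> Prop) k : is_subring R ->
    (forall n, has_prime_chain (dom_D D) n -> has_prime_chain R (k + n)) ->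
    (forall n, has_prime_chain R (k + n) -> has_prime_chain (dom_DX D) n.+1) ->
    (forall n, overring_chain R (k + n) <-> overring_chain (dom_D D) n) ->
    jaffard (dom_D D) <-> (jaffard R /\ dim_eq_succ (dom_DX D) (dom_D D)).
  move=> sR cDR cRX vRD; split=> [jD|[/(jaffardE sR)[m [c nv]] dimX]].
    split; last exact: dim.
    have /(jaffardE sD)[n [c nv]] := jD; apply/(jaffardE sR); exists (k + n)%N.
    by split; [exact: cDR | rewrite -addnS vRD].
  apply/(jaffardE sD); exists (m - k)%N.
  (* The zero ideal gives [v(D) >= 0], hence [v(R) >= k], so the subtraction [m - k] is not
     truncated. *)
  have km : (k <= m)%N.
    rewrite leqNgt; apply/negP => mk; apply: nv; have /vRD := overring_chain_self sD c0.
    by rewrite addn0; apply: overring_chain_leq.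
  (* Here the formula [dim D[X] = 1 + dim D] brings the chain down from [D[X]] to [D]. *)
  rewrite -(subnKC km) in c nv; split; first by apply/dimX; apply: cRX.
  by rewrite -vRD addnS.
have vD n : overring_chain (dom_D D) n -> overring_chain (dom_DX_loc (polysA D)) n.+1.
  by move/vDN/vNU/vUA.
split.
- by apply: (main _ _ 1%N) => // n; [move/cDN/cNU/cUA/cAX | split; [move/vXD | move/vD/vAX]].
- by apply: (main _ _ 1%N) => // n; [move/cDN/cNU/cUA | move/cAX | split; [move/vAX/vXD | move/vD]].
- by apply: (main _ _ 0%N) => // n; [move/cDN/cNU | move/cUA/cAX | split; [move/vUA/vAX/vXD | move/vDN/vNU]].
- by apply: (main _ _ 0%N) => // n; [move/cNU/cUA/cAX | split; [move/vNU/vUA/vAX/vXD | move/vDN]].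
Qed.
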